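(* Let $\varepsilon\in(0,1/2)$ and let $\mathcal M$ be a dynamic matroid that at any moment contains at most $n$ elements. There exists a fully dynamic randomized algorithm that maintains a value $\tilde\beta$ with $(1-\varepsilon)\beta\le\tilde\beta\le(1+\varepsilon)\beta$, where $\beta$ is the fractional covering number of the current matroid, using $O(\log^6 n/\varepsilon^8)$ worst-case rank-queries per update. The algorithm is correct with high probability against an oblivious adversary.
   Context: A matroid $\mathcal M=(E,\mathcal I)$ has rank function $\mathrm{rk}(A)=\max\{|A'|:A'\in\mathcal I, A'\subseteq A\}$. The fractional covering number is $\beta_{\mathcal M}=\max\{|A|/\mathrm{rk}(A): A\subseteq E, A\neq\emptyset\}$. The algorithm accesses the matroid only through a rank oracle returning $\mathrm{rk}(A)$ for a query $A$ of the current ground set. A dynamic matroid undergoes updates: deleting $e$ restricts $\mathcal M$ to $E\setminus\{e\}$; inserting $e$ replaces $\mathcal M$ by a matroid on $E\cup\{e\}$ with independent sets $\mathcal I\cup\mathcal I_e$ where every set in $\mathcal I_e$ contains $e$. An oblivious adversary fixes the whole update sequence in advance, independently of the algorithm's random choices. ''With high probability'' means with probability at least $1-n^{-c}$ for a constant $c\ge1$. *)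

(* Defs.v *)
From mathcomp Require Import all_boot all_order all_algebra finmap.
From mathcomp Require Import all_classical all_reals all_analysis.

Set Implicit Arguments.
Unset Strict Implicit.
Unset Printing Implicit Defensive.

Import Order.TTheory GRing.Theory Num.Theory.

Local Open Scope fset_scope.

Record matroid (U : choiceType) := Matroid {
  ground : {fset U};
  indep : pred {fset U};
  indep_ground : forall A, indep A -> A `<=` ground;
  indep_fset0 : indep fset0;
  indep_subset : forall A B, A `<=` B -> indep B -> indep A;
  indep_augment : forall A B, indep A -> indep B -> (#|` A| < #|` B|)%N ->
    exists2 x, x \in B `\` A & indep (x |` A) }.

Definition rk (U : choiceType) (M : matroid U) (A : {fset U}) : nat :=
  \max_(A' <- fpowerset A | indep M A') #|` A'|.

(* In \bar R one has 0^-1 = +oo, so the value is +oo exactly when M has a loop.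
   By convention it is 0 when the ground set is empty. *)
Definition fractional_covering_number (R : realType) (U : choiceType)
    (M : matroid U) : \bar R :=
  \big[maxe/0%E]_(A <- fpowerset (ground M) | A != fset0)
    ((#|` A|%:R)%:E / ((rk M A)%:R)%:E)%E.

Variant update (U : Type) := Insert of U | Delete of U.

(* In the insertion case, Ie is the family of new independent sets. *)
Definition updates_to (U : choiceType) (M : matroid U) (a : update U)
    (M' : matroid U) : Prop :=
  match a with
  | Insert e =>
      [/\ e \notin ground M, ground M' = e |` ground M &
          exists Ie : pred {fset U},
            (forall A, Ie A -> e \in A) /\
            (forall A, indep M' A = indep M A || Ie A)]
  | Delete e =>
      [/\ e \in ground M, ground M' = ground M `\ e &
          forall A, indep M' A = indep M A && (e \notin A)]
  end.

(* M 0 is the initial matroid and u t turns M t into M t.+1, for t < T; the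
   values of M beyond T and of u from T on are irrelevant. *)
Definition dynamic_matroid (U : choiceType) (n T : nat)
    (M : nat -> matroid U) (u : nat -> update U) : Prop :=
  (forall t, (t < T)%N -> updates_to (M t) (u t) (M t.+1)) /\
  (forall t, (t <= T)%N -> (#|` ground (M t)| <= n)%N).

(* Computations with access to a rank oracle, as decision trees: a node
   Query A f asks for the rank of A and continues with f applied to the answer;
   everything else is free of charge. *)
Inductive rank_prog (U : choiceType) (X : Type) :=
| Return of X
| Query of {fset U} & (nat -> rank_prog U X).

Fixpoint run (U : choiceType) (X : Type) (M : matroid U) (p : rank_prog U X) : X :=
  match p with
  | Return x => x
  | Query A f => run M (f (rk M A))
  end.

Fixpoint num_queries (U : choiceType) (X : Type) (M : matroid U)
    (p : rank_prog U X) : nat :=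
  match p with
  | Return _ => 0
  | Query A f => (num_queries M (f (rk M A))).+1
  end.

Fixpoint legal_queries (U : choiceType) (X : Type) (M : matroid U)
    (p : rank_prog U X) : Prop :=
  match p with
  | Return _ => True
  | Query A f => A `<=` ground M /\ legal_queries M (f (rk M A))
  end.

(* A deterministic dynamic algorithm. The initialization receives the initial
   ground set; an update step receives the update and runs with the rank oracle
   of the updated matroid; reading off the estimate makes no query. *)
Record dyn_algorithm (R : realType) (U : choiceType) := DynAlgorithm {
  state : Type;
  init : {fset U} -> rank_prog U state;
  step : update U -> state -> rank_prog U state;
  output : state -> \bar R }.

Fixpoint state_at (R : realType) (U : choiceType) (a : dyn_algorithm R U)
    (M : nat -> matroid U) (u : nat -> update U) (t : nat) : state a :=
  match t with
  | 0 => run (M 0) (init a (ground (M 0)))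
  | t'.+1 => run (M t'.+1) (step (u t') (state_at a M u t'))
  end.

Definition estimate (R : realType) (U : choiceType) (a : dyn_algorithm R U)
    (M : nat -> matroid U) (u : nat -> update U) (t : nat) : \bar R :=
  output (state_at a M u t).

(* Every execution only queries subsets of the current ground set, and each
   update (but not the initialization) makes at most q queries. *)
Definition respects_query_bound (R : realType) (U : choiceType) (q : R) (T : nat)
    (a : dyn_algorithm R U) (M : nat -> matroid U) (u : nat -> update U) : Prop :=
  legal_queries (M 0) (init a (ground (M 0))) /\
  forall t, (t < T)%N ->
    let p := step (u t) (state_at a M u t) in
    legal_queries (M t.+1) p /\ ((num_queries (M t.+1) p)%:R <= q)%R.

Definition correct_at (R : realType) (U : choiceType) (eps : R)
    (a : dyn_algorithm R U) (M : nat -> matroid U) (u : nat -> update U)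
    (t : nat) : Prop :=
  let beta := fractional_covering_number R (M t) in
  ((1 - eps)%:E * beta <= estimate a M u t <= (1 + eps)%:E * beta)%E.

(* Main.v *)
Require Import Defs.
From HB Require Import structures.
From mathcomp Require Import all_boot all_order all_algebra finmap.
From mathcomp Require Import all_classical all_reals all_analysis.
From mathcomp Require Import zify ring lra.

(* Elements receive slots in 'I_n.+1, and level j keeps the elements whose slot has
   a random seed below a 2^-j fraction of the range; since the adversary is
   oblivious, the slots at any time do not depend on the seed. If 2^-j beta is at
   least of order log n / eps^2, then with high probability the sampled matroid has
   covering number about 2^-j beta: Chernoff's bound for a densest set, and for all
   closures of independent sets I a union bound with failure probabilities n^(-a |I|).

   On each level we maintain a greedy packing of about log^2 n / eps^4 bases, each of
   minimum weight for the loads created by the previous ones. By the multiplicative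
   weights argument the least load of an element, divided by the number of bases, is
   about the inverse of the covering number as soon as the latter is
   O(log n / eps^2). The estimate is read off the first level on which this holds.

   Deleting an element can only increase the greedy loads of the others, by at most i
   units in total after i bases. So between two consecutive times only O(i) elements
   have to be moved in the order defining the i-th basis, and each move changes the
   basis by at most one exchange, which is found by bisection with O(log n) queries. *)

Set Implicit Arguments.
Unset Strict Implicit.

Import Order.TTheory GRing.Theory Num.Theory.
Local Open Scope fset_scope.

(** A greedy packing of [k] bases determines a covering number [b] up to a relative error [d] only
    if [k] is of order [b * ln n / d ^ 2], and repairing it after an update takes of order [k ^ 2]
    exchanges. Sampling removes the dependence on [b]: at the selected level the covering number is
    of order log n / eps^2, so [k] is of order log^2 n / eps^4. With log n levels and log n queries
    per exchange this gives log^6 n / eps^8.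

    The stored state is a function of the current matroid, the slots and the seed. Hence the query
    bound holds for every seed, and correctness at one time is a statement about a single static
    matroid; different times are combined only by a union bound.

    Seeds are attached to slots because arbitrarily many elements may occur over time, while at any
    moment [n.+1] independent seeds are enough and form a finite sample space. *)

Lemma in_fset_sep (U : choiceType) (E : {fset U}) (P : pred U) x :
  (x \in [fset y in E | P y]) = (x \in E) && P x.
Proof. by rewrite !inE. Qed.

(** * Rank and span in a matroid *)

Section Rank.
Context {U : choiceType} (M : matroid U).
Implicit Types A B I : {fset U}.

Lemma indep_card_le_rk I A : indep M I -> I `<=` A -> (#|` I| <= rk M A)%N.
Proof.
move=> indI sIA; rewrite /rk; apply: (@leq_bigmax_seq _ _ _ (fun I => #|` I|)) => //.
by rewrite fpowersetE.
Qed.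

Lemma rk_basis A : exists I, [/\ indep M I, I `<=` A & #|` I| = rk M A].
Proof.
rewrite /rk.
pose P r := exists2 I, indep M I & I `<=` A /\ #|` I| = r.
suff [I indI [sIA cI]] : P (\max_(I <- fpowerset A | indep M I) #|` I|) by exists I.
rewrite big_seq_cond; apply: (big_ind P).
- by exists fset0; [exact: indep_fset0 | split; [exact: fsub0set | rewrite cardfs0]].
- by move=> x y Px Py; rewrite /maxn; case: ifP.
- by move=> I /andP[+ indI]; rewrite fpowersetE => sIA; exists I.
Qed.

Lemma rk_mono A B : A `<=` B -> (rk M A <= rk M B)%N.
Proof.
move=> sAB; have [I [indI sIA <-]] := rk_basis A.
by apply: indep_card_le_rk => //; apply: fsubset_trans sAB.
Qed.

Lemma rk_le_card A : (rk M A <= #|` A|)%N.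
Proof. by have [I [_ /fsubset_leq_card sIA <-]] := rk_basis A. Qed.

Lemma rk_fset0 : rk M fset0 = 0.
Proof. by apply/eqP; rewrite -leqn0 -(cardfs0 U) rk_le_card. Qed.

Lemma rk_indep I : indep M I -> rk M I = #|` I|.
Proof. by move=> indI; apply/eqP; rewrite eqn_leq rk_le_card indep_card_le_rk. Qed.

Lemma rk_fsetU1 x A : (rk M (x |` A) <= (rk M A).+1)%N.
Proof.
have [I [indI sIA <-]] := rk_basis (x |` A).
rewrite (cardfsD1 x) -add1n leq_add ?leq_b1 //; apply: indep_card_le_rk.
  by apply: indep_subset indI; rewrite fsubD1set.
by rewrite fsubDset.
Qed.

Lemma indep_extend I A : indep M I -> I `<=` A ->
  exists J, [/\ indep M J, I `<=` J, J `<=` A & #|` J| = rk M A].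
Proof.
move=> indI sIA; move: {2}(rk M A - #|` I|)%N (leqnn (rk M A - #|` I|)) => m.
elim: m I indI sIA => [|m IH] I indI sIA lem.
  exists I; split => //; apply/eqP; rewrite eqn_leq indep_card_le_rk //.
  by move: lem; rewrite leqn0 subn_eq0.
have [K [indK sKA cK]] := rk_basis A.
have [ltIA|leAI] := ltnP #|` I| (rk M A); last first.
  exists I; split => //; apply/eqP; rewrite eqn_leq indep_card_le_rk //.
have [|x] := indep_augment indI indK; first by rewrite cK.
rewrite inE => /andP[xI xK] indxI.
have sxA : x |` I `<=` A by rewrite fsubUset fsub1set (fsubsetP sKA).
have [|J [? sJ ? ?]] := IH _ indxI sxA.
  by rewrite cardfsU1 xI; lia.
by exists J; split => //; apply: fsubset_trans sJ; apply: fsubsetU1.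
Qed.

Lemma rk_spanS x A B : A `<=` B -> rk M (x |` A) = rk M A ->
  rk M (x |` B) = rk M B.
Proof.
move=> sAB eqA; apply/eqP; rewrite eqn_leq (rk_mono (fsubsetU1 x B)) andbT leqNgt.
apply/negP => ltB.
have [I [indI sIA cI]] := rk_basis A.
have [J [indJ sIJ sJB cJ]] := indep_extend indI (fsubset_trans sIA sAB).
have [K [indK sKB cK]] := rk_basis (x |` B).
have [|y] := indep_augment indJ indK; first by rewrite cJ cK.
rewrite inE => /andP[yJ yK] indyJ.
have : y \in x |` B by apply: (fsubsetP sKB).
rewrite !inE => /orP[/eqP eyx|yB]; last first.
  have := @indep_card_le_rk (y |` J) B indyJ; rewrite cardfsU1 yJ cJ fsubUset fsub1set yB sJB.
  by move=> /(_ isT); rewrite add1n ltnn.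
subst y; have : indep M (x |` I) by apply: indep_subset indyJ; apply: fsetUS.
move=> /indep_card_le_rk /(_ (fsetUS _ sIA)).
rewrite eqA -cI cardfsU1; case: (boolP (x \in I)) => [xI|_]; last by rewrite add1n ltnn.
by rewrite (fsubsetP sIJ) in yJ.
Qed.

Lemma rk_fsetU_span A B : (forall x, x \in B -> rk M (x |` A) = rk M A) ->
  rk M (A `|` B) = rk M A.
Proof.
move=> spB.
have sp (s : seq U) : {subset s <= B} -> rk M (A `|` [fset x in s]) = rk M A.
  elim: s => [|x s IH] sB.
    by congr (rk M); apply/fsetP => y; rewrite !inE orbF.
  have -> : A `|` [fset y in x :: s] = x |` (A `|` [fset y in s]).
    by apply/fsetP => y; rewrite !inE; case: (y == x); rewrite ?orbT.
  rewrite (@rk_spanS x A) ?fsubsetUl ?spB ?sB ?mem_head //.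
  by rewrite IH // => y ys; rewrite sB // inE ys orbT.
by rewrite -{1}(sp (enum_fset B)) //; congr (rk M); apply/fsetP => y; rewrite !inE.
Qed.

End Rank.

(** * Greedy bases *)

Section GreedyBasis.
Context {U : choiceType}.
Implicit Types (key : U -> nat) (E A B : {fset U}) (r : {fset U} -> nat).

Definition below key E x := [fset y in E | (key y < key x)%N].

(** Membership of [x] depends only on the set of elements with smaller keys, so two orders can be
    compared one element at a time. The rank is an arbitrary function [r] so that a table of oracle
    answers can take its place. *)
Definition greedy_basis r key E :=
  [fset x in E | (r (below key E x) < r (x |` below key E x))%N].

Lemma in_greedy_basis r key E x : (x \in greedy_basis r key E) =
  (x \in E) && (r (below key E x) < r (x |` below key E x))%N.
Proof. by rewrite !inE. Qed.

Lemma greedy_basis_sub r key E : greedy_basis r key E `<=` E.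
Proof. by apply/fsubsetP => x; rewrite in_greedy_basis => /andP[]. Qed.

Lemma below_sub key E x : below key E x `<=` E.
Proof. by apply/fsubsetP => y; rewrite !inE => /andP[]. Qed.

Lemma eq_greedy_basis r r' key key' E :
  (forall A, A `<=` E -> r A = r' A) -> {in E, key =1 key'} ->
  greedy_basis r key E = greedy_basis r' key' E.
Proof.
move=> eqr eqk; apply/fsetP => x; rewrite !in_greedy_basis.
case: (boolP (x \in E)) => //= xE.
have eqb : below key E x = below key' E x.
  apply/fsetP => y; rewrite !inE; case: (boolP (y \in E)) => //= yE.
  by rewrite !eqk.
rewrite eqb !eqr ?below_sub //.
by rewrite fsubUset fsub1set xE below_sub.
Qed.

(** An element outside the span of a set is outside the span of every subset. This yields both the
    monotonicity of the loads under deletion and the bound on the trace of a greedy basis on a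
    subset. *)
Lemma greedy_basis_shrink (M : matroid U) key key' E E' x : x \in E' ->
  below key' E' x `<=` below key E x ->
  x \in greedy_basis (rk M) key E -> x \in greedy_basis (rk M) key' E'.
Proof.
move=> xE' sb; rewrite !in_greedy_basis xE' => /andP[_ ltP]; rewrite ltnNge.
apply/negP => leP; have /(rk_spanS sb) eqP : rk M (x |` below key' E' x) = rk M (below key' E' x).
  by apply/eqP; rewrite eqn_leq leP rk_mono // fsubsetU1.
by rewrite eqP ltnn in ltP.
Qed.

(** Optimality of the greedy basis: it contains a basis of every threshold set of the keys. As keys
    are distinct, each step of the induction on [t] adds at most one element. *)
Lemma rk_threshold (M : matroid U) key E t : {in E &, injective key} ->
  rk M [fset y in E | (key y < t)%N] =
  #|` [fset y in greedy_basis (rk M) key E | (key y < t)%N]|.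
Proof.
move=> injk; elim: t => [|t IH].
  have -> : [fset y in E | (key y < 0)%N] = fset0.
    by apply/fsetP => y; rewrite !inE andbF.
  have -> : [fset y in greedy_basis (rk M) key E | (key y < 0)%N] = fset0.
    by apply/fsetP => y; rewrite !inE andbF.
  by rewrite rk_fset0 cardfs0.
have [/hasP[/= x xE /eqP kx]|/hasPn noE] := boolP (has (fun x => key x == t) E); last first.
  have eqE : [fset y in E | (key y < t.+1)%N] = [fset y in E | (key y < t)%N].
    apply/fsetP => y; rewrite !inE; case: (boolP (y \in E)) => //= /noE; lia.
  rewrite eqE IH; congr #|` _|; apply/fsetP => y; rewrite !inE.
  by case: (boolP (y \in E)) => //= /noE ?; congr (_ && _); lia.
have bE : [fset y in E | (key y < t)%N] = below key E x.
  by apply/fsetP => y; rewrite !inE kx.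
have eqE : [fset y in E | (key y < t.+1)%N] = x |` below key E x.
  apply/fsetP => y; rewrite !inE /= kx ltnS leq_eqVlt.
  case: (eqVneq y x) => [->|neq] /=; first by rewrite xE kx eqxx.
  case: (boolP (y \in E)) => //= yE; case: eqP => //= ky.
  by move/eqP: neq => []; apply: injk => //; rewrite ky kx.
have JE := greedy_basis_sub (rk M) key E.
have xJE := in_greedy_basis (rk M) key E x.
rewrite eqE; move: IH JE xJE; move: (greedy_basis _ _ _) => J IH JE xJE.
have -> : [fset y in J | (key y < t.+1)%N] =
   if x \in J then x |` [fset y in J | (key y < t)%N] else [fset y in J | (key y < t)%N].
  apply/fsetP => y; case: ifPn => xJ; rewrite !inE /= ltnS leq_eqVlt.
    case: (eqVneq y x) => [->|neq] /=; first by rewrite xJ kx eqxx.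
    case: (boolP (y \in J)) => //= yJ; case: eqP => //= ky.
    move/eqP: neq => []; apply: injk => //; last by rewrite ky kx.
    exact: (fsubsetP JE).
  case: (boolP (y \in J)) => //= yJ; case: eqP => //= ky.
  have yx : y = x.
    apply: injk => //; last by rewrite ky kx.
    exact: (fsubsetP JE).
  by rewrite -yx yJ in xJ.
case: ifPn => xJ.
  rewrite cardfsU1 -IH bE.
  have -> /= : x \notin [fset y in J | (key y < t)%N] by rewrite !inE /= kx ltnn andbF.
  move: xJ; rewrite xJE xE /=.
  have := rk_fsetU1 M x (below key E x); lia.
rewrite -IH bE.
move: xJ; rewrite xJE xE /=.
have := rk_mono M (fsubsetU1 x (below key E x)); lia.
Qed.

Lemma key_bound key E : exists t, {in E, forall x, (key x < t)%N}.
Proof.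
exists (\sum_(x <- E) key x).+1 => x xE; rewrite ltnS (big_rem x) //=.
exact: leq_addr.
Qed.

Lemma card_greedy_basis (M : matroid U) key E : {in E &, injective key} ->
  #|` greedy_basis (rk M) key E| = rk M E.
Proof.
move=> injk; have [t tP] := key_bound key E.
have /= := rk_threshold M t injk.
have -> : [fset y in E | (key y < t)%N] = E.
  apply/fsetP => y; rewrite !inE /=; case: (boolP (y \in E)) => //= yE; exact: tP.
move: (greedy_basis_sub (rk M) key E); move: (greedy_basis _ _ _) => J JE ->.
congr #|` _|; apply/fsetP => y; rewrite !inE /=.
by case: (boolP (y \in J)) => //= yJ; apply/esym/tP/(fsubsetP JE).
Qed.

Lemma card_greedy_basisI (M : matroid U) key E A : {in E &, injective key} -> A `<=` E ->
  (#|` A `&` greedy_basis (rk M) key E| <= rk M A)%N.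
Proof.
move=> injk sAE; rewrite -(@card_greedy_basis M key A); last first.
  by move=> x y /(fsubsetP sAE) xE /(fsubsetP sAE); apply: injk.
apply/fsubset_leq_card/fsubsetP => x /fsetIP[xA]; apply: greedy_basis_shrink => //.
by apply/fsubsetP => y; rewrite !in_fset_sep => /andP[/(fsubsetP sAE) ->].
Qed.

Definition by_key key E := sort (fun x y => (key x <= key y)%N) (enum_fset E).

Lemma mem_by_key key E : by_key key E =i E.
Proof. by move=> x; rewrite mem_sort. Qed.

Lemma size_by_key key E : size (by_key key E) = #|` E|.
Proof. by rewrite size_sort. Qed.

Lemma index_by_key key E : {in E &, injective key} ->
  {in E &, forall x y, (index x (by_key key E) < index y (by_key key E))%N =
    (key x < key y)%N}.
Proof.
move=> injk.
have tr : transitive (fun x y => (key x <= key y)%N).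
  by move=> x y z; apply: leq_trans.
have so : sorted (fun x y => (key x <= key y)%N) (by_key key E).
  by apply: sort_sorted => x y; apply: leq_total.
have half x y : x \in E -> y \in E ->
    (index x (by_key key E) < index y (by_key key E))%N -> (key x < key y)%N.
  move=> xE yE lt; rewrite ltn_neqAle; apply/andP; split.
    by apply: contraTneq lt => /injk -> //; rewrite ltnn.
  by apply: (sorted_ltn_index tr so) lt; rewrite mem_by_key.
move=> x y xE yE; apply/idP/idP; first exact: half.
move=> lt; case: ltngtP => // [/half|] .
  by move=> /(_ yE xE); lia.
move=> eqi; have : x = y.
  rewrite -(nth_index x (_ : x \in by_key key E)) ?mem_by_key // eqi nth_index //.
  by rewrite mem_by_key.
by move=> eqxy; rewrite eqxy ltnn in lt.
Qed.

Definition init_seg key E m := [fset y in take m (by_key key E)].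

Lemma in_init_seg key E m y : (y \in init_seg key E m) =
  (y \in E) && (index y (by_key key E) < m)%N.
Proof.
rewrite !inE /=; case: (boolP (y \in E)) => yE.
  by rewrite in_take ?mem_by_key.
by apply: contraNF yE => /mem_take; rewrite mem_by_key.
Qed.

Lemma init_seg_sub key E m : init_seg key E m `<=` E.
Proof. by apply/fsubsetP => y; rewrite in_init_seg => /andP[]. Qed.

Lemma init_seg_threshold key E m : {in E &, injective key} -> exists t,
  forall y, y \in E -> (y \in init_seg key E m) = (key y < t)%N.
Proof.
move=> injk; have [t tP] := key_bound key E.
have [lt|le] := ltnP m (size (by_key key E)); last first.
  exists t => y yE; rewrite in_init_seg yE /= tP //.
  by apply: leq_trans le; rewrite index_mem mem_by_key.
have [x0 _] : exists x0 : U, True by case: (by_key key E) lt => // x; exists x.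
have xE : nth x0 (by_key key E) m \in E by rewrite -(mem_by_key key) mem_nth.
exists (key (nth x0 (by_key key E) m)) => y yE.
rewrite in_init_seg yE -(index_by_key injk) // index_uniq //.
by rewrite sort_uniq fset_uniq.
Qed.

(** The position at which [f] would be inserted into the list of [E] sorted by key; matroid rank is
    not involved. *)
Definition rank_pos key E f := find (fun y => (key f < key y)%N) (by_key key E).

Lemma rank_pos_le key E f : (rank_pos key E f <= size (by_key key E))%N.
Proof. exact: find_size. Qed.

Lemma lt_rank_pos key E f y : {in f |` E &, injective key} -> f \notin E ->
  y \in E -> (index y (by_key key E) < rank_pos key E f)%N = (key y < key f)%N.
Proof.
move=> injk fE yE.
have injE : {in E &, injective key}.
  by move=> u v uE vE; apply: injk; rewrite !inE ?uE ?vE orbT.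
have yL : y \in by_key key E by rewrite mem_by_key.
apply/idP/idP => [lt|].
  have := before_find y lt; rewrite nth_index // => kf.
  rewrite ltn_neqAle leqNgt kf andbT; apply: contraNneq fE => /injk <- //.
    by rewrite !inE yE orbT.
  by rewrite !inE eqxx.
apply: contraTT; rewrite -!leqNgt => le.
have lt : (rank_pos key E f < size (by_key key E))%N.
  by apply: leq_ltn_trans le _; rewrite index_mem.
have := nth_find y (_ : has (fun y => (key f < key y)%N) (by_key key E)).
rewrite has_find => /(_ lt) kf; apply: leq_trans (ltnW kf) _.
rewrite -/(rank_pos key E f).
have zE : nth y (by_key key E) (rank_pos key E f) \in E.
  by rewrite -(mem_by_key key) mem_nth.
rewrite leqNgt -(index_by_key injE) // -leqNgt index_uniq //.
by rewrite sort_uniq fset_uniq.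
Qed.

Lemma monotone_threshold (D : pred nat) lo hi : (lo <= hi)%N ->
  (forall m m', (lo <= m)%N -> (m <= m')%N -> (m' < hi)%N -> D m -> D m') ->
  exists tau, [/\ (lo <= tau)%N, (tau <= hi)%N &
    forall m, (lo <= m)%N -> (m < hi)%N -> D m = (tau <= m)%N].
Proof.
elim: hi => [|hi IH] lohi mono; first by exists lo; split => //; lia.
have [eqlo|ltlo] := eqVneq lo hi.+1; first by exists lo; split => //; lia.
have [||tau [lot tah tauP]] := IH; first by lia.
  by move=> m m' lom mm' lt; apply: mono => //; lia.
have [Dhi|nDhi] := boolP (D hi).
  exists tau; split => //; first lia.
  move=> m lom; rewrite ltnS leq_eqVlt => /orP[/eqP ->|]; last exact: tauP.
  by rewrite Dhi tah.
exists hi.+1; split => // m lom; rewrite ltnS => mhi.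
have -> : (hi.+1 <= m)%N = false by lia.
by apply: contraNF nDhi; apply: mono.
Qed.

(** Here [tau] is the first position, from that of [f] on, whose initial segment spans [f]. If
    [tau = a], then [f] is already spanned by its predecessors and nothing changes. Otherwise [f]
    enters the basis, and the element at position [tau.-1], which closes the circuit with [f],
    leaves it. *)
Lemma exchange_threshold (M : matroid U) key E f : {in f |` E &, injective key} ->
  f \notin E ->
  let L := by_key key E in let a := rank_pos key E f in
  let J := greedy_basis (rk M) key E in
  let J' := greedy_basis (rk M) key (f |` E) in
  exists tau, [/\ (a <= tau)%N, (tau <= (size L).+1)%N,
    forall m, (a <= m)%N -> (m < (size L).+1)%N ->
      (rk M (f |` init_seg key E m) == rk M (init_seg key E m)) = (tau <= m)%N,
    (f \in J') = (a < tau)%N &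
    {in E, forall x, (x \in J) = (x \in J') || (a < tau)%N && (index x L == tau.-1)
      /\ (x \in J') = (x \in J) && ~~ ((a < tau)%N && (index x L == tau.-1)) }].
Proof.
move=> injk fE /=.
set L := by_key key E; set a := rank_pos key E f.
have aL : (a <= size L)%N by apply: rank_pos_le.
have injE : {in E &, injective key}.
  by move=> u v uE vE; apply: injk; rewrite !inE ?uE ?vE orbT.
pose D m := rk M (f |` init_seg key E m) == rk M (init_seg key E m).
(* The value [tau = (size L).+1] means that [f] is not spanned by [E]; then [tau.-1 = size L] is the
   index of no element, and no element leaves. *)
have [||tau [atau tauL tauP]] := @monotone_threshold D a (size L).+1.
- exact: leqW.
- move=> m m' am mm' m'L /eqP Dm; apply/eqP; apply: rk_spanS Dm.
  by apply/fsubsetP => y; rewrite !in_init_seg => /andP[-> /=]; lia.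
exists tau; split => //.
  rewrite in_greedy_basis !inE eqxx /=.
  have -> : below key (f |` E) f = init_seg key E a.
    apply/fsetP => y; rewrite in_init_seg !inE.
    case: (eqVneq y f) => [->|] /=; first by rewrite ltnn (negbTE fE).
    by move=> _; case: (boolP (y \in E)) => //= yE; rewrite lt_rank_pos.
  have /= := tauP a (leqnn a) _; rewrite /D ltnS => /(_ aL).
  have := rk_mono M (fsubsetU1 f (init_seg key E a)); case: eqP; lia.
move=> x xE.
have xf : (x == f) = false by apply: contraNF fE => /eqP <-.
have bE : below key E x = init_seg key E (index x L).
  apply/fsetP => y; rewrite in_init_seg !inE; case: (boolP (y \in E)) => //= yE.
  by rewrite index_by_key.
have iL : (index x L < size L)%N by rewrite index_mem mem_by_key.
rewrite !in_greedy_basis xE !inE xE orbT /=.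
have [kxf|kfx] := ltnP (index x L) a.
  have -> : below key (f |` E) x = below key E x.
    apply/fsetP => y; rewrite !inE; case: (eqVneq y f) => [->|//] /=.
    by rewrite (negbTE fE) /=; move: kxf; rewrite /L /a lt_rank_pos //; lia.
  have -> : (a < tau)%N && (index x L == tau.-1) = false by lia.
  by rewrite orbF andbT.
have kfx' : (key f < key x)%N.
  move: kfx; rewrite leqNgt /L /a lt_rank_pos // -leqNgt leq_eqVlt => /orP[/eqP|//].
  by move=> /injk eqf; rewrite -eqf ?inE ?eqxx ?xE ?orbT // eqxx in xf.
have -> : below key (f |` E) x = f |` below key E x.
  by apply/fsetP => y; rewrite !inE; case: (eqVneq y f) => [->|//]; rewrite kfx'.
have eqS : x |` below key E x = init_seg key E (index x L).+1.
  rewrite bE; apply/fsetP => y; rewrite in_fsetU in_fset1 !in_init_seg.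
  case: (eqVneq y x) => [->|neq] /=; first by rewrite xE ltnSn.
  case: (boolP (y \in E)) => //= yE.
  have : index y L != index x L; last by rewrite /L; lia.
  apply: contraNneq neq => eqi.
  by rewrite -(nth_index x (_ : y \in L)) ?mem_by_key // eqi nth_index // mem_by_key.
have -> : x |` (f |` below key E x) = f |` (x |` below key E x) by rewrite fsetUCA.
rewrite eqS bE.
(* The two memberships of [x] differ only if [f] is outside the span of the segment before [x] and
   inside the span of the segment through [x], that is, if [tau = (index x L).+1]. The rank
   inequalities below encode this for [lia]. *)
have := tauP _ kfx (ltnW iL); have := tauP (index x L).+1 (leqW kfx) iL; rewrite /D.
have := rk_fsetU1 M x (init_seg key E (index x L)); rewrite -bE eqS bE.
have := rk_fsetU1 M x (f |` init_seg key E (index x L)); rewrite -{1}bE fsetUCA eqS.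
have := rk_fsetU1 M f (init_seg key E (index x L)).
have := rk_fsetU1 M f (init_seg key E (index x L).+1).
have := rk_mono M (fsubsetU1 f (init_seg key E (index x L))).
have := rk_mono M (fsubsetU1 f (init_seg key E (index x L).+1)).
have : init_seg key E (index x L) `<=` init_seg key E (index x L).+1 by rewrite -eqS bE fsubsetU1.
move=> sP; have := rk_mono M sP; have := rk_mono M (fsetUS [fset f] sP).
by case: eqP => ?; case: eqP => ?; lia.
Qed.

End GreedyBasis.

(** * Query programs *)

Section Programs.
Context {U : choiceType}.

Fixpoint bind (X Y : Type) (p : rank_prog U X) (f : X -> rank_prog U Y) :
    rank_prog U Y :=
  match p with
  | Return x => f x
  | Query A g => Query A (fun r => bind (g r) f)
  end.

Definition computes (X : Type) (M : matroid U) (p : rank_prog U X) (x : X) (q : nat) :=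
  [/\ run M p = x, (num_queries M p <= q)%N & legal_queries M p].

Lemma computes_return (X : Type) (M : matroid U) (x : X) q :
  computes M (Return U x) x q.
Proof. by []. Qed.

Lemma computes_query (X : Type) (M : matroid U) A (g : nat -> rank_prog U X) x q :
  A `<=` ground M -> computes M (g (rk M A)) x q -> computes M (Query A g) x q.+1.
Proof. by move=> sA [? ? ?]; split. Qed.

Lemma computes_bind (X Y : Type) (M : matroid U) (p : rank_prog U X)
    (f : X -> rank_prog U Y) x y q q' :
  computes M p x q -> computes M (f x) y q' -> computes M (bind p f) y (q + q').
Proof.
elim: p q => [x'|A g IH] q /=.
  by move=> [/= -> _ _] [? ? ?]; split => //; rewrite (leq_trans _ (leq_addl _ _)).
case: q => [[]//|q] [rx nq [sA lq]] cf; rewrite addSn; apply: computes_query => //.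
exact: IH.
Qed.

Lemma computes_leq (X : Type) (M : matroid U) (p : rank_prog U X) x q q' :
  (q <= q')%N -> computes M p x q -> computes M p x q'.
Proof. by move=> le [? nq ?]; split => //; apply: leq_trans le. Qed.

(* Finds by bisection the least [m] in [lo, lo + len) at which the rank of [A m]
   is [v m], assuming that this equality is monotone in [m]. *)
Fixpoint bisect (fuel lo len : nat) (A : nat -> {fset U}) (v : nat -> nat) :
    rank_prog U nat :=
  match fuel with
  | 0 => Return U lo
  | fuel.+1 =>
      if len == 0 then Return U lo else
      Query (A (lo + len./2)%N) (fun r =>
        if r == v (lo + len./2)%N then bisect fuel lo len./2 A v
        else bisect fuel (lo + len./2).+1%N (len - len./2).-1%N A v)
  end.

Lemma computes_bisect (M : matroid U) fuel lo len A v tau :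
  (len < 2 ^ fuel)%N -> (lo <= tau)%N -> (tau <= lo + len)%N ->
  (forall m, (lo <= m)%N -> (m < lo + len)%N ->
     A m `<=` ground M /\ (rk M (A m) == v m) = (tau <= m)%N) ->
  computes M (bisect fuel lo len A v) tau fuel.
Proof.
elim: fuel lo len => [|fuel IH] lo len /=.
  by rewrite expn0 => len0 lot tal _; split => //=; lia.
rewrite expnS => lt lot tal AP; case: eqP => [len0|/eqP len0].
  by split => //=; lia.
have [||sA eqv] := AP (lo + len./2)%N; [lia|lia|].
apply: computes_query => //; rewrite eqv; case: ifP => cmp.
  by apply: IH => //; [lia|move=> m ? ?; apply: AP; lia].
by apply: IH => //; [lia|lia|lia|move=> m ? ?; apply: AP; lia].
Qed.

Implicit Types (key : U -> nat) (E A B : {fset U}).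

(* The ranks of the initial segments of the ground set whose greedy basis is known
   are obtained by counting; only those of the other ground set are queried. Thus
   [delete_one] never queries a set containing f. *)
Definition delete_one F key E B f : rank_prog U {fset U} :=
  let L := by_key key (E `\ f) in
  let a := rank_pos key (E `\ f) f in
  bind (bisect F a ((size L).+1 - a) (init_seg key (E `\ f))
          (fun m => #|` [fset y in B | y \in f |` init_seg key (E `\ f) m]|))
    (fun tau => Return U
       [fset x in E `\ f | (x \in B) || (a < tau)%N && (index x L == tau.-1)]).

Definition insert_one F key E B f : rank_prog U {fset U} :=
  let L := by_key key (E `\ f) in
  let a := rank_pos key (E `\ f) f in
  bind (bisect F a ((size L).+1 - a) (fun m => f |` init_seg key (E `\ f) m)
          (fun m => #|` [fset y in B | y \in init_seg key (E `\ f) m]|))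
    (fun tau => Return U
       [fset x in E | if x == f then (a < tau)%N
          else (x \in B) && ~~ ((a < tau)%N && (index x L == tau.-1))]).

Lemma rk_init_seg (M : matroid U) key E m : {in E &, injective key} ->
  rk M (init_seg key E m) =
  #|` [fset y in greedy_basis (rk M) key E | y \in init_seg key E m]|.
Proof.
move=> injk; have [t tP] := init_seg_threshold m injk.
have -> : init_seg key E m = [fset y in E | (key y < t)%N].
  apply/fsetP => y; rewrite [RHS]in_fset_sep.
  case: (boolP (y \in E)) => [yE|yE] /=; first exact: tP.
  by apply: contraNF yE => /(fsubsetP (init_seg_sub _ _ _)).
rewrite rk_threshold //; move: (greedy_basis_sub (rk M) key E).
move: (greedy_basis _ _ _) => J JE; congr #|` _|; apply/fsetP => y.
by rewrite !inE /=; case: (boolP (y \in J)) => //= /(fsubsetP JE) ->.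
Qed.

(** From the position of [f] on, a segment together with [f] is again a threshold set of the keys on
    [E], so that its rank is a count in the stored basis. *)
Lemma rk_init_segU1 (M : matroid U) key E f m : {in E &, injective key} -> f \in E ->
  (rank_pos key (E `\ f) f <= m)%N ->
  rk M (f |` init_seg key (E `\ f) m) =
  #|` [fset y in greedy_basis (rk M) key E | y \in f |` init_seg key (E `\ f) m]|.
Proof.
move=> injk fE am.
have fE' : f \notin E `\ f by rewrite !inE eqxx.
have eqE : f |` (E `\ f) = E by rewrite fsetD1K.
have injU : {in f |` (E `\ f) &, injective key} by rewrite eqE.
have injE' : {in E `\ f &, injective key}.
  by move=> u v /fsetD1P[_ uE] /fsetD1P[_ vE]; apply: injk.
have [t tP] := init_seg_threshold m injE'.
have -> : f |` init_seg key (E `\ f) m = [fset y in E | (key y < maxn t (key f).+1)%N].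
  apply/fsetP => y; rewrite in_fset1U [RHS]in_fset_sep.
  case: (eqVneq y f) => [->|neq] /=; first by rewrite fE leq_maxr.
  case: (boolP (y \in E)) => yE /=; last first.
    apply: contraNF yE => /(fsubsetP (init_seg_sub _ _ _)); by rewrite in_fsetD1 neq.
  have yE' : y \in E `\ f by rewrite in_fsetD1 neq.
  have pos := lt_rank_pos injU fE' yE'.
  have := in_init_seg key (E `\ f) m y; rewrite yE' /=.
  rewrite tP // => inP'; rewrite leq_max.
  have [//|le] := ltnP (key y) t; rewrite /= ltnS.
  have : key y != key f by apply: contraNneq neq => /injk ->.
  by move: inP' pos; lia.
rewrite rk_threshold //; move: (greedy_basis_sub (rk M) key E).
move: (greedy_basis _ _ _) => J JE; congr #|` _|; apply/fsetP => y.
by rewrite !inE /=; case: (boolP (y \in J)) => //= /(fsubsetP JE) ->.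
Qed.

(** Two matroids occur because the stored basis belongs to [M], while the oracle already answers for
    the updated matroid [N], whose ground set may lack [f]. They need to agree only on subsets of
    [E] without [f]. *)
Lemma computes_delete_one (M N : matroid U) F key E f : {in E &, injective key} ->
  f \in E -> (#|` E| < 2 ^ F)%N ->
  (forall A, A `<=` E `\ f -> A `<=` ground N /\ rk N A = rk M A) ->
  computes N (delete_one F key E (greedy_basis (rk M) key E) f)
    (greedy_basis (rk N) key (E `\ f)) F.
Proof.
move=> injk fE ltF NM.
have fE' : f \notin E `\ f by rewrite !inE eqxx.
have eqE : f |` (E `\ f) = E by rewrite fsetD1K.
have injU : {in f |` (E `\ f) &, injective key} by rewrite eqE.
have [tau []] := exchange_threshold M injU fE'.
rewrite eqE => atau tauL tauP _ J'P.
rewrite -[X in computes _ _ _ X]addn0; apply: computes_bind.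
  apply: (computes_bisect (tau := tau)).
  - apply: leq_ltn_trans ltF; rewrite size_by_key (cardfsD1 f E) fE; lia.
  - exact: atau.
  - by have := rank_pos_le key (E `\ f) f; lia.
  move=> m am mL; have [sA eqr] := NM _ (init_seg_sub key (E `\ f) m).
  split => //; rewrite eqr -rk_init_segU1 // eq_sym tauP //.
  by have := rank_pos_le key (E `\ f) f; lia.
split => //=; have -> : greedy_basis (rk N) key (E `\ f) = greedy_basis (rk M) key (E `\ f).
  by apply: eq_greedy_basis => // A /NM[].
apply/fsetP => x; rewrite [LHS]in_fset_sep.
case: (boolP (x \in E `\ f)) => [xE|xE] /=; first by have [-> _] := J'P _ xE.
by apply/esym; apply: contraNF xE => /(fsubsetP (greedy_basis_sub _ _ _)).
Qed.

Lemma computes_insert_one (M : matroid U) F key E f : {in E &, injective key} ->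
  f \in E -> (#|` E| < 2 ^ F)%N -> E `<=` ground M ->
  computes M (insert_one F key E (greedy_basis (rk M) key (E `\ f)) f)
    (greedy_basis (rk M) key E) F.
Proof.
move=> injk fE ltF EM.
have fE' : f \notin E `\ f by rewrite !inE eqxx.
have eqE : f |` (E `\ f) = E by rewrite fsetD1K.
have injU : {in f |` (E `\ f) &, injective key} by rewrite eqE.
have injE' : {in E `\ f &, injective key}.
  by move=> u v /fsetD1P[_ uE] /fsetD1P[_ vE]; apply: injk.
have [tau []] := exchange_threshold M injU fE'.
rewrite eqE => atau tauL tauP fJ J'P.
rewrite -[X in computes _ _ _ X]addn0; apply: computes_bind.
  apply: (computes_bisect (tau := tau)).
  - apply: leq_ltn_trans ltF; rewrite size_by_key (cardfsD1 f E) fE; lia.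
  - exact: atau.
  - by have := rank_pos_le key (E `\ f) f; lia.
  move=> m am mL; split.
    apply: fsubset_trans EM; rewrite -[X in _ `<=` X]eqE; apply: fsetUS; exact: init_seg_sub.
  rewrite -rk_init_seg // tauP //.
  by have := rank_pos_le key (E `\ f) f; lia.
split => //=; apply/fsetP => x; rewrite [LHS]in_fset_sep.
case: (boolP (x \in E)) => [xE|xE] /=; last first.
  by apply/esym; apply: contraNF xE => /(fsubsetP (greedy_basis_sub _ _ _)).
case: (eqVneq x f) => [->|neq]; first by rewrite fJ.
by have [|_ ->] := J'P x; rewrite // in_fsetD1 neq.
Qed.

Fixpoint delete_all F key E B fs : rank_prog U {fset U} :=
  if fs is f :: fs' then
    bind (delete_one F key E B f) (fun B' => delete_all F key (E `\ f) B' fs')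
  else Return U B.

Fixpoint insert_all F key E B fs : rank_prog U {fset U} :=
  if fs is f :: fs' then
    bind (insert_all F key (E `\ f) B fs') (fun B' => insert_one F key E B' f)
  else Return U B.

Lemma fsetD_cons E f fs : E `\` [fset x in f :: fs] = (E `\ f) `\` [fset x in fs].
Proof. by apply/fsetP => x; rewrite !inE negb_or; case: (x == f); rewrite ?andbF. Qed.

Lemma computes_delete_all (M : matroid U) F key E fs : {in E &, injective key} ->
  uniq fs -> {subset fs <= E} -> (#|` E| < 2 ^ F)%N -> E `<=` ground M ->
  computes M (delete_all F key E (greedy_basis (rk M) key E) fs)
    (greedy_basis (rk M) key (E `\` [fset x in fs])) (size fs * F).
Proof.
elim: fs E => [|f fs IH] E injk /=.
  move=> _ _ _ _; have -> : E `\` [fset x in [::]] = E by apply/fsetP => x; rewrite !inE.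
  exact: computes_return.
move=> /andP[ffs ufs] sE ltF EM; rewrite fsetD_cons mulSn.
have fE : f \in E by apply: sE; rewrite mem_head.
have sE' : E `\ f `<=` E by apply: fsubD1set.
apply: computes_bind.
  apply: (@computes_delete_one M) => // A sA; split => //.
  exact: fsubset_trans (fsubset_trans sA sE') EM.
apply: IH => //.
- by move=> u v /fsetD1P[_ uE] /fsetD1P[_ vE]; apply: injk.
- move=> x xs; rewrite in_fsetD1 sE ?inE ?xs ?orbT // andbT.
  by apply: contraNneq ffs => <-.
- by apply: leq_ltn_trans ltF; apply: fsubset_leq_card.
- exact: fsubset_trans EM.
Qed.

Lemma computes_insert_all (M : matroid U) F key E fs : {in E &, injective key} ->
  uniq fs -> {subset fs <= E} -> (#|` E| < 2 ^ F)%N -> E `<=` ground M ->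
  computes M (insert_all F key E (greedy_basis (rk M) key (E `\` [fset x in fs])) fs)
    (greedy_basis (rk M) key E) (size fs * F).
Proof.
elim: fs E => [|f fs IH] E injk /=.
  move=> _ _ _ _; have -> : E `\` [fset x in [::]] = E by apply/fsetP => x; rewrite !inE.
  exact: computes_return.
move=> /andP[ffs ufs] sE ltF EM; rewrite fsetD_cons mulSnr.
have fE : f \in E by apply: sE; rewrite mem_head.
have sE' : E `\ f `<=` E by apply: fsubD1set.
apply: computes_bind; last exact: computes_insert_one.
apply: IH => //.
- by move=> u v /fsetD1P[_ uE] /fsetD1P[_ vE]; apply: injk.
- move=> x xs; rewrite in_fsetD1 sE ?inE ?xs ?orbT // andbT.
  by apply: contraNneq ffs => <-.
- by apply: leq_ltn_trans ltF; apply: fsubset_leq_card.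
- exact: fsubset_trans EM.
Qed.

(** Once all elements with a changed key are removed, the two orders coincide on the rest. The
    intermediate basis is therefore greedy for both keys, and each changed element costs one removal
    and one insertion. *)
Definition rekey F key key' E B : rank_prog U {fset U} :=
  let fs := [seq x <- enum_fset E | key x != key' x] in
  bind (delete_all F key E B fs) (fun B' => insert_all F key' E B' fs).

Lemma computes_rekey (M : matroid U) F key key' E :
  {in E &, injective key} -> {in E &, injective key'} -> (#|` E| < 2 ^ F)%N ->
  E `<=` ground M ->
  computes M (rekey F key key' E (greedy_basis (rk M) key E))
    (greedy_basis (rk M) key' E) (2 * count (fun x => key x != key' x) E * F).
Proof.
move=> injk injk' ltF EM; rewrite mul2n -addnn mulnDl -!size_filter.
set fs := [seq x <- _ | _].
have ufs : uniq fs by rewrite filter_uniq ?fset_uniq.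
have sfs : {subset fs <= E} by move=> x; rewrite mem_filter => /andP[].
apply: computes_bind; first exact: computes_delete_all.
have -> : greedy_basis (rk M) key (E `\` [fset x in fs]) =
          greedy_basis (rk M) key' (E `\` [fset x in fs]).
  apply: eq_greedy_basis => // x; rewrite !inE mem_filter negb_and negbK /=.
  by move=> /andP[/orP[/eqP -> //|/negP xE] /xE].
exact: computes_insert_all.
Qed.

Definition rekey_delete F e E key key' B : rank_prog U {fset U} :=
  bind (delete_one F key E B e) (rekey F key key' (E `\ e)).

Definition rekey_insert F e E key key' B : rank_prog U {fset U} :=
  bind (rekey F key key' (E `\ e) B) (fun B' => insert_one F key' E B' e).

Lemma computes_rekey_delete (M N : matroid U) F key key' E e : e \in E ->
  {in E &, injective key} -> {in E `\ e &, injective key'} -> (#|` E| < 2 ^ F)%N ->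
  (forall A, A `<=` E `\ e -> A `<=` ground N /\ rk N A = rk M A) ->
  computes N (rekey_delete F e E key key' (greedy_basis (rk M) key E))
    (greedy_basis (rk N) key' (E `\ e))
    ((2 * count (fun x => key x != key' x) (E `\ e)).+1 * F).
Proof.
move=> eE injk injk' ltF NM; rewrite mulSn.
apply: computes_bind; first exact: computes_delete_one.
apply: computes_rekey => //.
- by move=> u v /fsetD1P[_ uE] /fsetD1P[_ vE]; apply: injk.
- by apply: leq_ltn_trans ltF; apply/fsubset_leq_card/fsubD1set.
- by have [] := NM _ (fsubset_refl _).
Qed.

Lemma computes_rekey_insert (M N : matroid U) F key key' E e : e \in E ->
  {in E `\ e &, injective key} -> {in E &, injective key'} -> (#|` E| < 2 ^ F)%N ->
  (forall A, A `<=` E `\ e -> rk N A = rk M A) -> E `<=` ground N ->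
  computes N (rekey_insert F e E key key' (greedy_basis (rk M) key (E `\ e)))
    (greedy_basis (rk N) key' E)
    ((2 * count (fun x => key x != key' x) (E `\ e)).+1 * F).
Proof.
move=> eE injk injk' ltF NM EN; rewrite mulSnr.
have -> : greedy_basis (rk M) key (E `\ e) = greedy_basis (rk N) key (E `\ e).
  by apply: eq_greedy_basis => // A /NM ->.
apply: computes_bind; last exact: computes_insert_one.
apply: computes_rekey => //.
- by move=> u v /fsetD1P[_ uE] /fsetD1P[_ vE]; apply: injk'.
- by apply: leq_ltn_trans ltF; apply/fsubset_leq_card/fsubD1set.
- exact: fsubset_trans (fsubD1set _ _) EN.
Qed.

End Programs.

(** * Greedy packings of bases *)

Section Packing.
Context {U : choiceType} {m : nat}.
Implicit Types (sl : U -> 'I_m) (l : U -> nat) (E A B : {fset U}) (r : {fset U} -> nat).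

(* Lexicographic comparison of (load, slot), as slots are less than m. *)
Definition load_key sl l x := (l x * m + sl x)%N.

Definition add_load l B x := (l x + (x \in B))%N.

Fixpoint packing r sl l E k : seq {fset U} :=
  if k is k'.+1 then
    let B := greedy_basis r (load_key sl l) E in B :: packing r sl (add_load l B) E k'
  else [::].

Lemma load_key_inj sl l E : {in E &, injective sl} -> {in E &, injective (load_key sl l)}.
Proof.
move=> injs x y xE yE eqk; apply: injs => //; apply: val_inj.
have m0 : (0 < m)%N := leq_ltn_trans (leq0n _) (ltn_ord (sl x)).
move: eqk => /(congr1 (modn^~ m)); rewrite /load_key !modnMDl.
by rewrite !modn_small.
Qed.

Lemma load_key_neq sl l l' x : (load_key sl l x != load_key sl l' x) = (l x != l' x).
Proof.
have m0 : (0 < m)%N := leq_ltn_trans (leq0n _) (ltn_ord (sl x)).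
by rewrite /load_key eqn_add2r eqn_pmul2r.
Qed.

Lemma eq_packing r r' sl sl' l l' E k : (forall A, A `<=` E -> r A = r' A) ->
  {in E, sl =1 sl'} -> {in E, l =1 l'} ->
  packing r sl l E k = packing r' sl' l' E k.
Proof.
move=> eqr eqs; elim: k l l' => //= k IH l l' eql.
have eqB : greedy_basis r (load_key sl l) E = greedy_basis r' (load_key sl' l') E.
  by apply: eq_greedy_basis => // x xE; rewrite /load_key eql // eqs.
by rewrite -eqB; congr (_ :: _); apply: IH => x xE; rewrite /add_load eql.
Qed.

Lemma size_packing r sl l E k : size (packing r sl l E k) = k.
Proof. by elim: k l => //= k IH l; rewrite IH. Qed.

Section Dominance.
Variables (M : matroid U) (sl : U -> 'I_m) (E : {fset U}) (e : U).

(** With [l] the loads in the presence of [e] and [l'] those in its absence, [D] bounds the total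
    excess. Loads being integers, it also bounds the number of elements whose key differs. *)
Definition dominated D l l' := {in E `\ e, forall x, (l x <= l' x)%N} /\
  (\sum_(x <- E `\ e) l' x <= \sum_(x <- E `\ e) l x + D)%N.

Lemma count_dominated D l l' : dominated D l l' ->
  (count (fun x => load_key sl l x != load_key sl l' x) (E `\ e) <= D)%N.
Proof.
move=> [dom le]; rewrite (eq_count (load_key_neq sl l l')).
have -> : count (fun x => l x != l' x) (E `\ e) = (\sum_(x <- E `\ e) (l x != l' x))%N.
  by rewrite -sum1_count big_mkcond; apply: eq_bigr => x _; case: (_ != _).
rewrite -(leq_add2l (\sum_(x <- E `\ e) l x)) (leq_trans _ le) //.
rewrite -big_split /= big_seq [leqRHS]big_seq.
apply: leq_sum => x xE'; have := dom x xE'.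
by case: eqP => /=; lia.
Qed.

Lemma sum_mem_fset A B : B `<=` A -> (\sum_(x <- A) (x \in B) = #|` B|)%N.
Proof.
move=> BA; rewrite -sum1_size -(big_fset_incl _ BA) /=.
  by rewrite !big_seq; apply: eq_bigr => x xB; rewrite xB.
by move=> x _ /negbTE ->.
Qed.

Hypotheses (injs : {in E &, injective sl}) (eE : e \in E).

(* Removing e only lets elements enter the greedy basis, so the loads after
   the removal dominate the loads before, and the total loads differ by at most
   one more unit, because the two bases have ranks rk (E `\ e) <= rk E. *)
Lemma dominated_add_load D l l' : dominated D l l' ->
  dominated D.+1 (add_load l (greedy_basis (rk M) (load_key sl l) E))
    (add_load l' (greedy_basis (rk M) (load_key sl l') (E `\ e))).
Proof.
move=> [dom le].
have injs' : {in E `\ e &, injective sl}.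
  by move=> u v /fsetD1P[_ uE] /fsetD1P[_ vE]; apply: injs.
have sE' : E `\ e `<=` E by apply: fsubD1set.
set B := greedy_basis _ _ E; set B' := greedy_basis _ _ (E `\ e).
have BE : B `<=` E := greedy_basis_sub _ _ _.
have BE' : B' `<=` E `\ e := greedy_basis_sub _ _ _.
have cB : #|` B| = rk M E by apply/card_greedy_basis/load_key_inj.
have cB' : #|` B'| = rk M (E `\ e) by apply/card_greedy_basis/load_key_inj.
split; last first.
  rewrite /add_load !big_split /= (sum_mem_fset BE') cB'.
  have cBe : (rk M E <= \sum_(x <- E `\ e) (x \in B) + 1)%N.
    rewrite -cB -(sum_mem_fset BE) (big_fsetD1 e) //= addnC leq_add2l.
    exact: leq_b1.
  have := rk_mono M sE'; lia.
move=> x xE'; have xE := fsubsetP sE' _ xE'; rewrite /add_load.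
(* A strict inequality survives one more unit on the left. Only for equal loads must membership in
   [B] imply membership in [B']; then every element preceding [x] in the new order also preceded it
   in the old one. *)
have := dom x xE'; rewrite leq_eqVlt => /orP[/eqP eqx|]; last first.
  by move=> lt; have := leq_b1 (x \in B); lia.
rewrite eqx leq_add2l; case: (boolP (x \in B)) => // xB.
suff -> : x \in B' by [].
apply: greedy_basis_shrink xB => //.
apply/fsubsetP => y; rewrite !in_fset_sep => /andP[yE' lty].
rewrite (fsubsetP sE') //=; apply: leq_ltn_trans (_ : load_key sl l' y < _)%N.
  by rewrite leq_add2r leq_mul2r dom ?orbT.
by move: lty; rewrite /load_key eqx.
Qed.

End Dominance.

Fixpoint update_packing (rebase : (U -> nat) -> (U -> nat) -> {fset U} -> rank_prog U {fset U})
    sl l l' bs : rank_prog U (seq {fset U}) :=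
  if bs is B :: bs' then
    bind (rebase (load_key sl l) (load_key sl l') B) (fun B' =>
      bind (update_packing rebase sl (add_load l B) (add_load l' B') bs')
        (fun bs'' => Return U (B' :: bs'')))
  else Return U [::].

(** The excess grows by one per basis, so the costs are consecutive odd multiples of [F]: the sum of
    [2 * (D + i) + 1] over [i < k] is [k * (2 * D + k)]. *)
Lemma packing_cost D k F :
  ((2 * D).+1 * F + (k * (2 * D.+1 + k) * F + 0) = k.+1 * (2 * D + k.+1) * F)%N.
Proof. by rewrite addn0 -mulnDl; congr (_ * F)%N; nia. Qed.

Lemma computes_update_delete (M N : matroid U) F sl E e D l l' k : e \in E ->
  {in E &, injective sl} -> (#|` E| < 2 ^ F)%N ->
  (forall A, A `<=` E `\ e -> A `<=` ground N /\ rk N A = rk M A) ->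
  dominated E e D l l' ->
  computes N (update_packing (rekey_delete F e E) sl l l' (packing (rk M) sl l E k))
    (packing (rk N) sl l' (E `\ e) k) (k * (2 * D + k) * F).
Proof.
move=> eE injs ltF NM; elim: k D l l' => [|k IH] D l l' dom /=; first exact: computes_return.
rewrite -packing_cost.
have injs' : {in E `\ e &, injective sl}.
  by move=> u v /fsetD1P[_ uE] /fsetD1P[_ vE]; apply: injs.
apply: computes_bind.
  apply: computes_leq (computes_rekey_delete _ _ _ _ NM) => //; try exact: load_key_inj.
  by rewrite leq_mul2r ltnS leq_mul2l (count_dominated sl dom) !orbT.
apply: computes_bind; last exact: computes_return.
have -> : greedy_basis (rk N) (load_key sl l') (E `\ e) =
          greedy_basis (rk M) (load_key sl l') (E `\ e).
  by apply: eq_greedy_basis => // A /NM[].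
by apply: IH; apply: dominated_add_load.
Qed.

(** Insertion is deletion read backwards: the old loads, without [e], dominate the new ones, which
    is why [l'] precedes [l] in the last hypothesis. *)
Lemma computes_update_insert (M N : matroid U) F sl E e D l l' k : e \in E ->
  {in E &, injective sl} -> (#|` E| < 2 ^ F)%N ->
  (forall A, A `<=` E `\ e -> rk N A = rk M A) -> E `<=` ground N ->
  dominated E e D l' l ->
  computes N
    (update_packing (rekey_insert F e E) sl l l' (packing (rk M) sl l (E `\ e) k))
    (packing (rk N) sl l' E k) (k * (2 * D + k) * F).
Proof.
move=> eE injs ltF NM EN; elim: k D l l' => [|k IH] D l l' dom /=; first exact: computes_return.
rewrite -packing_cost.
have injs' : {in E `\ e &, injective sl}.
  by move=> u v /fsetD1P[_ uE] /fsetD1P[_ vE]; apply: injs.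
apply: computes_bind.
  apply: computes_leq (computes_rekey_insert _ _ _ _ NM _) => //; try exact: load_key_inj.
  rewrite leq_mul2r ltnS leq_mul2l.
  rewrite (eq_count (a2 := fun x => load_key sl l' x != load_key sl l x)); last first.
    by move=> x; rewrite eq_sym.
  by rewrite (count_dominated sl dom) !orbT.
apply: computes_bind; last exact: computes_return.
have -> : greedy_basis (rk M) (load_key sl l) (E `\ e) =
          greedy_basis (rk N) (load_key sl l) (E `\ e).
  by apply: eq_greedy_basis => // A /NM.
by apply: IH; apply: dominated_add_load.
Qed.

End Packing.

(** * The dynamic algorithm *)

Lemma eq_rk (U : choiceType) (M N : matroid U) (A : {fset U}) :
  (forall B, B `<=` A -> indep M B = indep N B) -> rk M A = rk N A.
Proof.
move=> eqI; rewrite /rk big_seq_cond [RHS]big_seq_cond; apply: eq_bigl => B.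
by rewrite fpowersetE; case: (boolP (B `<=` A)) => //= /eqI.
Qed.

Lemma rk_insert (U : choiceType) (M N : matroid U) e A :
  updates_to M (Insert e) N -> A `<=` ground M -> rk N A = rk M A.
Proof.
move=> [eM _ [Ie [IeP NP]]] sA; apply: eq_rk => B sB; rewrite NP.
case: (boolP (Ie B)) => [/IeP eB|_]; last by rewrite orbF.
by rewrite (fsubsetP sA) ?(fsubsetP sB) in eM.
Qed.

Lemma rk_delete (U : choiceType) (M N : matroid U) e A :
  updates_to M (Delete e) N -> A `<=` ground M `\ e -> rk N A = rk M A.
Proof.
move=> [eM _ NP] sA; apply: eq_rk => B sB; rewrite NP.
suff -> : e \notin B by rewrite andbT.
by apply/negP => /(fsubsetP sB) /(fsubsetP sA); rewrite !inE eqxx.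
Qed.

Section Tabulate.
Context {U : choiceType}.

(** Initialization is exempt from the query bound, so it may read off the ranks of all subsets and
    compute the state from the table. *)
Fixpoint tabulate (s : seq {fset U}) : rank_prog U ({fset U} -> nat) :=
  if s is A :: s' then
    Query A (fun v => bind (tabulate s') (fun tab =>
      Return U (fun B => if B == A then v else tab B)))
  else Return U (fun=> 0).

Lemma computes_tabulate (M : matroid U) s : {in s, forall A, A `<=` ground M} ->
  exists2 tab, computes M (tabulate s) tab (size s) & {in s, tab =1 rk M}.
Proof.
elim: s => [|A s IH] sM; first by exists (fun=> 0).
have [|tab ctab tabP] := IH.
  by move=> B sB; apply: sM; rewrite inE sB orbT.
exists (fun B => if B == A then rk M A else tab B); last first.
  by move=> B; rewrite inE; case: eqP => [-> //|_ /=]; apply: tabP.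
rewrite /= -[size s]addn0.
apply: computes_query; first by apply: sM; rewrite mem_head.
apply: computes_bind ctab _; exact: computes_return.
Qed.

End Tabulate.

Definition sampled (U : choiceType) (T : finType) (Q : nat) (sl : U -> T) q
    (w : {ffun T -> 'I_Q.+1}) (A : {fset U}) :=
  [fset x in A | (w (sl x) < q)%N].

Section Algorithm.
Context {R : realType} {U : choiceType}.
(* slots 0, ..., n, levels 0, ..., h, k bases per level, F bisection steps, and the
   threshold K on the estimates of the single levels *)
Variables (n h k F : nat) (K : R) (w : {ffun 'I_n.+1 -> 'I_((2 ^ h).-1.+1)}).
Implicit Types (sl : U -> 'I_n.+1) (E A B : {fset U}) (r : {fset U} -> nat).

Record packing_state := PackingState {
  cur_ground : {fset U};
  cur_slot : U -> 'I_n.+1;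
  cur_loops : {fset U};
  cur_packings : seq (seq {fset U}) }.

Definition sample sl j E := sampled sl (2 ^ (h - j)) w E.

(** The invariant of the algorithm: every update turns the canonical state of one matroid into that
    of the next. Loops are recorded separately because they make the covering number infinite. *)
Definition canonical_state r E sl := PackingState E sl
  [fset x in E | r [fset x] == 0]
  [seq packing r sl (fun=> 0) (sample sl j E) k | j <- iota 0 h.+1].

Definition init_slot E (x : U) : 'I_n.+1 := inord (index x (enum_fset E)).

(** With at most [n] elements present and [n.+1] slots a free slot exists, so the default [ord0] is
    not reached. *)
Definition fresh_slot sl E : 'I_n.+1 :=
  odflt ord0 [pick i | i \notin [seq sl x | x <- enum_fset E]].

Definition insert_slot sl E e (x : U) := if x == e then fresh_slot sl E else sl x.

Fixpoint update_levels (f : nat -> seq {fset U} -> rank_prog U (seq {fset U})) j ps :=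
  if ps is bs :: ps' then
    bind (f j bs) (fun bs' => bind (update_levels f j.+1 ps') (fun ps'' =>
      Return U (bs' :: ps'')))
  else Return U [::].

Definition init_state E : rank_prog U packing_state :=
  bind (tabulate (enum_fset (fpowerset E))) (fun tab =>
    Return U (canonical_state tab E (init_slot E))).

Definition step_state (u : update U) (s : packing_state) : rank_prog U packing_state :=
  match u with
  | Insert e =>
      let sl := insert_slot (cur_slot s) (cur_ground s) e in
      let E := e |` cur_ground s in
      Query [fset e] (fun v =>
        bind (update_levels (fun j bs =>
            let S := sample sl j E in
            if e \in S then
              update_packing (rekey_insert F e S) sl (fun=> 0) (fun=> 0) bs
            else Return U bs) 0 (cur_packings s))
          (fun ps => Return U (PackingState E sl
             (if v == 0 then e |` cur_loops s else cur_loops s) ps)))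
  | Delete e =>
      let sl := cur_slot s in
      bind (update_levels (fun j bs =>
          let S := sample sl j (cur_ground s) in
          if e \in S then
            update_packing (rekey_delete F e S) sl (fun=> 0) (fun=> 0) bs
          else Return U bs) 0 (cur_packings s))
        (fun ps => Return U (PackingState (cur_ground s `\ e) sl (cur_loops s `\ e) ps))
  end.

(** No load exceeds [k] when there are [k] bases, so the start value [k] affects only an empty
    [S]. *)
Definition min_load (bs : seq {fset U}) S :=
  \big[minn/k]_(x <- S) count (fun B : {fset U} => x \in B) bs.

Definition level_load (s : packing_state) j :=
  min_load (nth [::] (cur_packings s) j) (sample (cur_slot s) j (cur_ground s)).

(** For positive [k] the test says that the load is nonzero and that [k / load], the estimate for
    the sampled matroid, is at most [K]. The factor [2 ^+ j] undoes the sampling. *)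
Definition output_state (s : packing_state) : \bar R :=
  if cur_loops s != fset0 then +oo%E else
  if cur_ground s == fset0 then 0%E else
  let j := find (fun j => k%:R <= K * (level_load s j)%:R)%R (iota 0 h.+1) in
  (k%:R / (level_load s j)%:R * 2 ^+ j)%:E%R.

Definition packing_algorithm : dyn_algorithm R U :=
  @DynAlgorithm R U packing_state init_state step_state output_state.

(** The slot component of a run, computed without reference to the seed, so that bad seeds at time
    [t] can be counted with this assignment held fixed. *)
Fixpoint slot_at (M : nat -> matroid U) (u : nat -> update U) t : U -> 'I_n.+1 :=
  if t is t'.+1 then
    if u t' is Insert e then insert_slot (slot_at M u t') (ground (M t')) e
    else slot_at M u t'
  else init_slot (ground (M 0)).

Lemma init_slot_inj E : (#|` E| <= n)%N -> {in E &, injective (init_slot E)}.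
Proof.
move=> le x y xE yE /(congr1 val); rewrite /= !inordK.
- by move=> eqi; rewrite -(nth_index x xE) eqi nth_index.
- by rewrite ltnS (leq_trans _ le) // ltnW // index_mem.
- by rewrite ltnS (leq_trans _ le) // ltnW // index_mem.
Qed.

Lemma fresh_slotP sl E : (#|` E| <= n)%N -> {in E, forall x, sl x != fresh_slot sl E}.
Proof.
move=> le x xE; rewrite /fresh_slot; case: pickP => [i /=|no].
  by apply: contraNneq => <-; rewrite map_f.
have : (#|'I_n.+1| <= size [seq sl x | x <- enum_fset E])%N.
  apply: leq_trans (card_size _); apply: subset_leq_card; apply/fintype.subsetP => i _.
  by have /negbFE := no i.
by rewrite card_ord size_map ltnNge le.
Qed.

Lemma insert_slot_inj sl E e : (#|` E| <= n)%N -> {in E &, injective sl} ->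
  {in e |` E &, injective (insert_slot sl E e)}.
Proof.
move=> le injs x y; rewrite !in_fset1U /insert_slot.
have [->|_] := eqVneq x e; have [->|_] //= := eqVneq y e.
- by move=> _ yE /esym/eqP; rewrite (negbTE (fresh_slotP sl le yE)).
- by move=> xE _ /eqP; rewrite (negbTE (fresh_slotP sl le xE)).
- exact: injs.
Qed.

Lemma eq_canonical_state r r' E sl : (forall A, A `<=` E -> r A = r' A) ->
  canonical_state r E sl = canonical_state r' E sl.
Proof.
move=> eqr; congr PackingState.
  apply/fsetP => x; rewrite !in_fset_sep; case: (boolP (x \in E)) => //= xE.
  by rewrite eqr // fsub1set.
apply: eq_map => j; apply: eq_packing => // A sA; apply: eqr.
by apply: fsubset_trans sA _; apply/fsubsetP => x; rewrite in_fset_sep => /andP[].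
Qed.

Lemma computes_init_state (M : matroid U) : exists q,
  computes M (init_state (ground M))
    (canonical_state (rk M) (ground M) (init_slot (ground M))) q.
Proof.
have [A|tab ctab tabP] := @computes_tabulate _ M (enum_fset (fpowerset (ground M))).
  by rewrite fpowersetE.
exists (size (enum_fset (fpowerset (ground M))) + 0)%N; apply: computes_bind ctab _.
rewrite (@eq_canonical_state tab (rk M)); first exact: computes_return.
by move=> A sA; apply: tabP; rewrite fpowersetE.
Qed.

Lemma computes_update_levels (N : matroid U) f (g g' : nat -> seq {fset U}) c j len :
  (forall i, computes N (f i (g i)) (g' i) c) ->
  computes N (update_levels f j [seq g i | i <- iota j len])
    [seq g' i | i <- iota j len] (len * c).
Proof.
move=> fP; elim: len j => [|len IH] j /=; first exact: computes_return.
rewrite mulSn -[(len * c)%N]addn0; apply: computes_bind (fP j) _.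
apply: computes_bind (IH j.+1) _; exact: computes_return.
Qed.

Lemma dominated0 E e : dominated E e 0 (fun=> 0) (fun=> 0).
Proof. by split=> // ; rewrite addn0. Qed.

(** All packings start from zero loads, hence the excess [0]. The additional query decides whether
    an inserted element is a loop. *)
Definition step_cost := (h.+1 * (k * (2 * 0 + k) * F)).+1.

Lemma computes_step_insert (M N : matroid U) sl e : (#|` ground N| < 2 ^ F)%N ->
  (#|` ground N| <= n)%N ->
  {in ground M &, injective sl} -> updates_to M (Insert e) N ->
  computes N (step_state (Insert e) (canonical_state (rk M) (ground M) sl))
    (canonical_state (rk N) (ground N) (insert_slot sl (ground M) e)) step_cost.
Proof.
move=> ltF len injs up; have [eM gN _] := up; rewrite /=.
set sl' := insert_slot _ _ _; rewrite -gN.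
have eN : e \in ground N by rewrite gN !inE eqxx.
have gM : ground N `\ e = ground M by rewrite gN fsetU1K.
have cM : (#|` ground M| <= n)%N by rewrite (leq_trans _ len) // -gM fsubset_leq_card ?fsubD1set.
have injs' : {in ground N &, injective sl'} by rewrite gN; apply: insert_slot_inj.
have eqs : {in ground M, sl' =1 sl}.
  move=> x xM; rewrite /sl' /insert_slot; case: eqP => // ex.
  by rewrite -ex xM in eM.
apply: computes_query; first by rewrite fsub1set.
rewrite -[(h.+1 * _)%N]addn0; apply: computes_bind.
  apply: (computes_update_levels 0 h.+1
    (g' := fun j => packing (rk N) sl' (fun=> 0) (sample sl' j (ground N)) k)) => j /=.
  have sS : sample sl' j (ground N) `<=` ground N.
    by apply/fsubsetP => x; rewrite in_fset_sep => /andP[].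
  have eqS : sample sl j (ground M) = sample sl' j (ground N) `\ e.
    apply/fsetP => x; rewrite in_fsetD1 !in_fset_sep -gM in_fsetD1.
    case: (eqVneq x e) => //= neq; case: (boolP (x \in ground N)) => //= xN.
    by rewrite eqs // -gM in_fsetD1 neq.
  have sSM : sample sl' j (ground N) `\ e `<=` ground M by rewrite -gM fsetSD.
  have eqP : packing (rk M) sl (fun=> 0) (sample sl j (ground M)) k =
      packing (rk M) sl' (fun=> 0) (sample sl' j (ground N) `\ e) k.
    rewrite eqS; apply: eq_packing => // x xS; rewrite eqs //.
    exact: (fsubsetP sSM).
  rewrite eqP; case: ifP => eS.
    apply: computes_update_insert => //.
    - by move=> x y xS yS; apply: injs'; apply: (fsubsetP sS).
    - by apply: leq_ltn_trans ltF; apply: fsubset_leq_card.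
    - move=> A sA; apply: rk_insert up _; exact: fsubset_trans sA sSM.
    - exact: dominated0.
  have eqS' : sample sl' j (ground N) `\ e = sample sl' j (ground N).
    by rewrite mem_fsetD1 // eS.
  rewrite eqS' (_ : packing (rk M) _ _ _ _ = packing (rk N) sl' (fun=> 0) (sample sl' j (ground N)) k).
    exact: computes_return.
  apply: eq_packing => // A sA; apply/esym/(rk_insert up).
  by apply: fsubset_trans sA _; rewrite -eqS'.
suff -> : canonical_state (rk N) (ground N) sl' = PackingState (ground N) sl'
   (if rk N [fset e] == 0 then e |` [fset x in ground M | rk M [fset x] == 0]
    else [fset x in ground M | rk M [fset x] == 0])
   [seq packing (rk N) sl' (fun=> 0) (sample sl' j (ground N)) k | j <- iota 0 h.+1].
  exact: computes_return.
congr PackingState; apply/fsetP => x; rewrite in_fset_sep gN in_fset1U.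
have [->|neq] /= := eqVneq x e.
  case: ifP => e0; first by rewrite in_fset1U eqxx.
  by rewrite in_fset_sep (negbTE eM).
transitivity (x \in [fset x in ground M | rk M [fset x] == 0]); last first.
  by case: ifP => // _; rewrite in_fset1U (negbTE neq).
rewrite in_fset_sep; case: (boolP (x \in ground M)) => //= xM.
by rewrite (rk_insert up) // fsub1set.
Qed.

Lemma computes_step_delete (M N : matroid U) sl e : (#|` ground M| < 2 ^ F)%N ->
  {in ground M &, injective sl} -> updates_to M (Delete e) N ->
  computes N (step_state (Delete e) (canonical_state (rk M) (ground M) sl))
    (canonical_state (rk N) (ground N) sl) step_cost.
Proof.
move=> ltF injs up; have [eM gN _] := up; rewrite /=.
apply: computes_leq (leqnSn _) _.
rewrite -[(h.+1 * _)%N]addn0; apply: computes_bind.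
  apply: (computes_update_levels 0 h.+1
    (g' := fun j => packing (rk N) sl (fun=> 0) (sample sl j (ground N)) k)) => j /=.
  have sS : sample sl j (ground M) `<=` ground M.
    by apply/fsubsetP => x; rewrite in_fset_sep => /andP[].
  have eqS : sample sl j (ground N) = sample sl j (ground M) `\ e.
    apply/fsetP => x; rewrite in_fsetD1 !in_fset_sep gN in_fsetD1.
    by case: (eqVneq x e).
  have sSN : sample sl j (ground M) `\ e `<=` ground N by rewrite gN fsetSD.
  rewrite eqS; case: ifP => eS.
    apply: computes_update_delete => //.
    - by move=> x y xS yS; apply: injs; apply: (fsubsetP sS).
    - by apply: leq_ltn_trans ltF; apply: fsubset_leq_card.
    - move=> A sA; split; first exact: fsubset_trans sA sSN.
      by apply: rk_delete up _; rewrite -gN; exact: fsubset_trans sA sSN.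
    - exact: dominated0.
  have eqS' : sample sl j (ground M) `\ e = sample sl j (ground M).
    by rewrite mem_fsetD1 // eS.
  rewrite eqS' (_ : packing (rk M) _ _ _ _ = packing (rk N) sl (fun=> 0) (sample sl j (ground M)) k).
    exact: computes_return.
  apply: eq_packing => // A sA; apply/esym/(rk_delete up).
  by rewrite -gN; apply: fsubset_trans sA _; rewrite -eqS'.
rewrite -gN; suff -> : canonical_state (rk N) (ground N) sl = PackingState (ground N) sl
   ([fset x in ground M | rk M [fset x] == 0] `\ e)
   [seq packing (rk N) sl (fun=> 0) (sample sl j (ground N)) k | j <- iota 0 h.+1].
  exact: computes_return.
congr PackingState; apply/fsetP => x; rewrite in_fset_sep in_fsetD1 in_fset_sep gN in_fsetD1.
have [->//|neq] /= := eqVneq x e; case: (boolP (x \in ground M)) => //= xM.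
by rewrite (rk_delete up) // fsub1set in_fsetD1 neq.
Qed.

Section Run.
Variables (T : nat) (M : nat -> matroid U) (u : nat -> update U).
Hypotheses (nF : (n < 2 ^ F)%N) (dyn : dynamic_matroid n T M u).

Lemma slot_at_inj t : (t <= T)%N -> {in ground (M t) &, injective (slot_at M u t)}.
Proof.
have [up size_le] := dyn; elim: t => [|t IH] tT /=; first exact/init_slot_inj/size_le.
have {IH} := IH (ltnW tT); have := up t tT.
case: (u t) => e /= [eM gN _] injs; rewrite gN.
  by apply: insert_slot_inj => //; apply: size_le; apply: ltnW.
by move=> x y /fsetD1P[_ xM] /fsetD1P[_ yM]; apply: injs.
Qed.

Lemma computes_step_at t : (t < T)%N ->
  computes (M t.+1)
    (step_state (u t) (canonical_state (rk (M t)) (ground (M t)) (slot_at M u t)))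
    (canonical_state (rk (M t.+1)) (ground (M t.+1)) (slot_at M u t.+1)) step_cost.
Proof.
move=> tT; have [up size_le] := dyn.
have injs := slot_at_inj (ltnW tT); have := up t tT; rewrite /=.
case: (u t) => e upt.
  by apply: computes_step_insert => //; [apply: leq_ltn_trans nF|]; apply: size_le.
by apply: computes_step_delete => //; apply: leq_ltn_trans nF; apply/size_le/ltnW.
Qed.

Lemma state_at_canonical t : (t <= T)%N ->
  state_at packing_algorithm M u t =
  canonical_state (rk (M t)) (ground (M t)) (slot_at M u t).
Proof.
elim: t => [|t IH] tT /=; first by have [q []] := computes_init_state (M 0).
by rewrite IH ?(ltnW tT) //; have [] := computes_step_at tT.
Qed.

Lemma packing_algorithm_bound (q : R) : (step_cost%:R <= q)%R ->
  respects_query_bound q T packing_algorithm M u.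
Proof.
move=> le; split; first by have [q' []] := computes_init_state (M 0).
move=> t tT /=; rewrite state_at_canonical ?(ltnW tT) //.
have [_ nq lq] := computes_step_at tT; split => //.
by apply: Order.POrderTheory.le_trans le; rewrite ler_nat.
Qed.

End Run.

End Algorithm.

(** * Loads of greedy packings *)

Section MinLoad.
Context {R : realType} {U : choiceType} {m : nat}.
Variables (M : matroid U) (sl : U -> 'I_m) (S : {fset U}).
Hypothesis (injs : {in S &, injective sl}).
Implicit Types (l : U -> nat) (A B : {fset U}).

Lemma min_load_le k bs x : x \in S ->
  (min_load k bs S <= count (fun B : {fset U} => x \in B) bs)%N.
Proof.
rewrite /min_load; change (x \in S) with (x \in enum_fset S).
elim: (enum_fset S) => // y s IH; rewrite inE big_cons => /orP[/eqP <-|/IH].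
  exact: geq_minl.
exact: leq_trans (geq_minr _ _).
Qed.

Lemma min_load_attained k bs : S != fset0 -> (size bs <= k)%N ->
  exists2 x, x \in S & count (fun B : {fset U} => x \in B) bs = min_load k bs S.
Proof.
move=> /fset0Pn[x0 x0S] le; pose F x := count (fun B : {fset U} => x \in B) bs.
suff [eqk|//] : min_load k bs S = k \/ exists2 x, x \in S & F x = min_load k bs S.
  exists x0 => //; apply/eqP; rewrite eqn_leq min_load_le // andbT eqk.
  exact: leq_trans (count_size _ _) le.
rewrite /min_load big_seq; apply: (big_ind (fun v => v = k \/ exists2 x, x \in S & F x = v)).
- by left.
- by move=> x y Px Py; rewrite /minn; case: ifP.
- by move=> x xS; right; exists x.
Qed.

Lemma sum_load A bs :
  (\sum_(x <- A) count (fun B : {fset U} => x \in B) bs = \sum_(B <- bs) #|` A `&` B|)%N.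
Proof.
under eq_bigr do rewrite -sum1_count big_mkcond.
rewrite exchange_big; apply: eq_bigr => B _ /=.
rewrite -(@sum_mem_fset _ A (A `&` B)) ?fsubsetIl //.
by rewrite !big_seq; apply: eq_bigr => x xA; rewrite in_fsetI xA.
Qed.

(** Double counting: the total load on [A] is the sum of the sizes of the traces of the [k] bases on
    [A], each at most [rk M A]. *)
Lemma min_load_upper k A : A `<=` S ->
  (min_load k (packing (rk M) sl (fun=> 0) S k) S * #|` A| <= k * rk M A)%N.
Proof.
move=> sAS; set bs := packing _ _ _ _ _.
apply: (@leq_trans (\sum_(x <- A) count (fun B : {fset U} => x \in B) bs)%N).
  rewrite -sum1_size big_distrr /= !big_seq; apply: leq_sum => x xA.
  by rewrite muln1 min_load_le // (fsubsetP sAS).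
rewrite sum_load /bs; elim: k (fun=> 0) {bs} => [|k IH] l /=; first by rewrite big_nil.
rewrite big_cons mulSn leq_add ?IH //.
by apply: card_greedy_basisI => //; apply: load_key_inj.
Qed.

Local Open Scope ring_scope.

(* Layer-cake decomposition of the sum over the level sets of l. *)
Lemma sum_level_ge0 (c : U -> R) (g : nat -> R) l :
  (forall j, 0 <= g j) -> (forall j, g j.+1 <= g j) ->
  (forall j, 0 <= \sum_(x <- S) (l x <= j)%:R * c x) ->
  0 <= \sum_(x <- S) g (l x) * c x.
Proof.
move=> g0 gS cS; have [t tP] := key_bound l S.
have gE j : (j <= t)%N -> g j = \sum_(0 <= i < t) (j <= i)%:R * (g i - g i.+1) + g t.
  move=> jt; rewrite (big_cat_nat (leq0n j) jt) /= big_nat big1 ?add0r; last first.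
    by move=> i /andP[_ ij]; rewrite leqNgt ij mul0r.
  rewrite big_nat (eq_bigr (fun i => g i - g i.+1)); last first.
    by move=> i /andP[-> _]; rewrite mul1r.
  rewrite -big_nat (eq_bigr (fun i => - (g i.+1 - g i))); last by move=> i _; rewrite opprB.
  by rewrite sumrN telescope_sumr // opprB subrK.
have -> : \sum_(x <- S) g (l x) * c x =
    \sum_(0 <= i < t) (g i - g i.+1) * (\sum_(x <- S) (l x <= i)%:R * c x) +
    g t * \sum_(x <- S) (l x <= t)%:R * c x.
  under [X in _ = X + _]eq_bigr do rewrite big_distrr.
  rewrite exchange_big big_distrr -big_split /= !big_seq; apply: eq_bigr => x xS.
  have ltx : (l x <= t)%N := ltnW (tP x xS).
  rewrite {1}(gE _ ltx) ltx mul1r mulrDl; congr (_ + _).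
  by rewrite big_distrl; apply: eq_bigr => i _ /=; ring.
apply: addr_ge0; last exact: mulr_ge0.
by apply: sumr_ge0 => i _; rewrite mulr_ge0 // subr_ge0.
Qed.

Variables (d b : R).
Hypotheses (d0 : 0 < d) (b0 : 0 < b).
Hypothesis (cover : forall A, A `<=` S -> #|` A|%:R <= b * (rk M A)%:R).

(** The potential of the multiplicative weights method; it is at least the single term given by an
    element of least load. *)
Definition load_potential l := \sum_(x <- S) expR (- d * (l x)%:R) : R.

(* The greedy basis has maximum weight for every weight that decreases with the
   load, and the constant vector 1/b lies in the independence polytope. *)
Lemma greedy_basis_weight l : load_potential l / b <=
  \sum_(x <- S) expR (- d * (l x)%:R) *
    (x \in greedy_basis (rk M) (load_key sl l) S)%:R.
Proof.
rewrite -subr_ge0 /load_potential mulr_suml -sumrB.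
set B := greedy_basis _ _ _.
under eq_bigr do rewrite -mulrBr.
apply: (@sum_level_ge0 (fun x => (x \in B)%:R - b^-1) (fun j => expR (- d * j%:R))).
- by move=> j; apply: expR_ge0.
- by move=> j; rewrite ler_expR !mulNr lerN2 ler_pM2l // ler_nat.
move=> j; pose C := [fset x in S | (l x <= j)%N].
have CS : C `<=` S by apply/fsubsetP => x; rewrite in_fset_sep => /andP[].
have sumC (f : U -> R) : \sum_(x <- S) (l x <= j)%:R * f x = \sum_(x <- C) f x.
  rewrite -(big_fset_incl _ CS) /=.
    rewrite !big_seq; apply: eq_bigr => x; rewrite in_fset_sep => /andP[_ ->].
    by rewrite mul1r.
  move=> x xS; rewrite in_fset_sep xS /= => /negbTE ->; exact: mul0r.
rewrite sumC sumrB subr_ge0.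
have -> : \sum_(x <- C) b^-1 = #|` C|%:R / b.
  by rewrite big_const_seq count_predT iter_addr_0 mulr_natl.
rewrite ler_pdivrMr // mulrC; apply: le_trans (cover CS) _.
rewrite ler_pM2l // -natr_sum ler_nat.
have -> : (\sum_(x <- C) (x \in B) = #|` C `&` B|)%N.
  rewrite -(@sum_mem_fset _ C) ?fsubsetIl // !big_seq; apply: eq_bigr => x xC.
  by rewrite in_fsetI xC.
(* Slots are less than [m], so a level set of the load is a threshold set of the lexicographic key,
   and [rk_threshold] applies to it. *)
have ltk x : (load_key sl l x < j.+1 * m)%N = (l x <= j)%N.
  rewrite /load_key -ltnS; have := ltn_ord (sl x); nia.
have -> : C = [fset x in S | (load_key sl l x < j.+1 * m)%N].
  by apply/fsetP => x; rewrite !in_fset_sep ltk.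
have thr : rk M [fset x in S | (load_key sl l x < j.+1 * m)%N] =
    #|` [fset x in B | (load_key sl l x < j.+1 * m)%N]|.
  by apply: rk_threshold; apply: load_key_inj.
have BS : B `<=` S := greedy_basis_sub _ _ _.
rewrite thr; clearbody B; apply: fsubset_leq_card; apply/fsubsetP => x.
rewrite in_fsetI !in_fset_sep => /andP[xB ->]; rewrite xB !andbT.
exact: (fsubsetP BS).
Qed.

(** The weights of the elements of the new basis shrink by the factor [expR (- d)], and these
    elements carry at least the fraction [1 / b] of the potential. The exponential form follows from
    [1 - x <= expR (- x)]. *)
Lemma load_potential_add_load l :
  load_potential (add_load l (greedy_basis (rk M) (load_key sl l) S)) <=
  load_potential l * expR (- ((1 - expR (- d)) / b)).
Proof.
have := greedy_basis_weight l; set B := greedy_basis _ _ _ => le.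
apply: (@le_trans _ _ (load_potential l * (1 - (1 - expR (- d)) / b))); last first.
  rewrite ler_wpM2l ?expR_ge1Dx //; first by apply: sumr_ge0 => x _; apply: expR_ge0.
have -> : load_potential (add_load l B) = load_potential l -
    (1 - expR (- d)) * \sum_(x <- S) expR (- d * (l x)%:R) * (x \in B)%:R.
  rewrite /load_potential big_distrr -sumrB; apply: eq_bigr => x _ /=.
  rewrite /add_load natrD mulrDr expRD; case: (x \in B); rewrite ?mulr1 ?mulr0 ?expR0.
    by rewrite mulrBl mul1r opprB addrCA subrr addr0 mulrC.
  by rewrite subr0 mulr1.
rewrite mulrBr mulr1 lerD2l lerN2 mulrCA ler_wpM2l //.
  by rewrite subr_ge0 -expR0 ler_expR oppr_le0 ltW.
Qed.

Lemma load_potential_packing k l :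
  \sum_(x <- S) expR (- d * (l x + count (fun B : {fset U} => x \in B)
                                   (packing (rk M) sl l S k))%:R) <=
  load_potential l * expR (- (k%:R * ((1 - expR (- d)) / b))).
Proof.
elim: k l => [|k IH] l /=.
  rewrite mul0r oppr0 expR0 mulr1; apply: ler_sum => x _; by rewrite addn0.
set B := greedy_basis _ _ _.
under eq_bigr do rewrite addnA.
apply: le_trans (IH (add_load l B)) _.
set y := (1 - _) / b.
have -> : - (k.+1%:R * y) = - y + - (k%:R * y) by rewrite -(natr1 k); ring.
rewrite expRD mulrA ler_wpM2r ?expR_ge0 //.
exact: load_potential_add_load.
Qed.

(** The term of an element of least load is at most the final potential, which is at most
    [n * expR (- k * (1 - expR (- d)) / b)]. Take logarithms and use
    [1 - expR (- d) >= d / (1 + d)], a consequence of [1 + d <= expR d]. *)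
Lemma min_load_lower k n : S != fset0 -> (#|` S| <= n)%N ->
  k%:R / ((1 + d) * b) <=
  (min_load k (packing (rk M) sl (fun=> 0) S k) S)%:R + ln n%:R / d.
Proof.
move=> S0 Sn; set bs := packing _ _ _ _ _.
have [|x xS eqx] := @min_load_attained k bs S0; first by rewrite size_packing.
have n0 : (0 < n)%N by apply: leq_trans Sn; rewrite cardfs_gt0.
have le : expR (- d * (min_load k bs S)%:R) <=
    expR (ln n%:R - k%:R * ((1 - expR (- d)) / b)).
  rewrite expRD lnK ?posrE ?ltr0n //.
  have := load_potential_packing k (fun=> 0).
  rewrite /load_potential mulr0 expR0 big_const_seq count_predT iter_addr_0 => pot.
  apply: (@le_trans _ _ (#|` S|%:R * expR (- (k%:R * ((1 - expR (- d)) / b))))); last first.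
    by rewrite ler_wpM2r ?expR_ge0 // ler_nat.
  apply: le_trans pot; rewrite (big_rem x) //= -/bs add0n eqx lerDl.
  by apply: sumr_ge0 => y _; apply: expR_ge0.
move: le; rewrite ler_expR => le.
have d1 : d / (1 + d) <= 1 - expR (- d).
  rewrite expRN; have := expR_ge1Dx d; set e := expR d => ed.
  have e0 : 0 < e := expR_gt0 d.
  have p0 : 0 < 1 + d by rewrite addr_gt0.
  have : e^-1 <= (1 + d)^-1 by rewrite lef_pV2.
  have -> : d / (1 + d) = 1 - (1 + d)^-1 by field; rewrite gt_eqF.
  lra.
have k1 : k%:R * (d / (1 + d) / b) <= k%:R * ((1 - expR (- d)) / b).
  by rewrite ler_wpM2l // ler_wpM2r // invr_ge0 ltW.
have eqd : k%:R * (d / (1 + d) / b) = d * (k%:R / ((1 + d) * b)).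
  by rewrite invfM; ring.
have dl : d * (ln n%:R / d) = ln n%:R :> R.
  by rewrite mulrCA divff ?mulr1 // gt_eqF.
rewrite -(ler_pM2l d0) mulrDr dl -eqd.
by move: le k1; lra.
Qed.

End MinLoad.

Local Open Scope ring_scope.

(** * Sampling *)

Section Chernoff.
Context {R : realType}.

(** Invert [1 - x / 2 <= expR (- (x / 2))] and square. Halving [x] is essential: the direct bound
    [1 / (1 - x)] exceeds [1 + x + x ^+ 2] for [0 < x < 1]. *)
Lemma expR_le_quadratic (x : R) : `|x| <= 1 / 4 -> expR x <= 1 + x + x ^+ 2.
Proof.
rewrite ler_norml => /andP[xl xu].
have h : expR (x / 2) <= (1 - x / 2)^-1.
  have := expR_ge1Dx (- (x / 2)); rewrite expRN => le.
  rewrite -[leLHS]invrK lef_pV2 ?posrE ?invr_gt0 ?expR_gt0 //; lra.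
have -> : expR x = expR (x / 2) ^+ 2 by rewrite expr2 -expRD; congr expR; field.
apply: (@le_trans _ _ ((1 - x / 2)^-1 ^+ 2)).
  by rewrite ler_sqr ?nnegrE ?expR_ge0 // invr_ge0; lra.
rewrite exprVn invf_ple ?posrE.
- by rewrite -div1r ler_pdivrMr; nra.
- by rewrite exprn_gt0 //; lra.
- by nra.
Qed.

Context {T : finType} {Q : nat}.
Variables (q : nat) (qQ : (q <= Q.+1)%N).
Implicit Types (B : {set T}) (w : {ffun T -> 'I_Q.+1}).

Definition hits B w := #|[set i in B | (w i < q)%N]|.

Let p : R := q%:R / Q.+1%:R.
Let N : R := #|{ffun T -> 'I_Q.+1}|%:R.

(** Probabilities are treated as numbers of seeds out of [N]. Independence of the slots is the
    distributivity of a product over sums, applied to the sum over all functions [w]. *)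
Lemma sum_expR_hits B (x : R) :
  \sum_w expR (x * (hits B w)%:R) = N * (1 + p * (expR x - 1)) ^+ #|B|.
Proof.
pose F i (v : 'I_Q.+1) : R := if (i \in B) && (v < q)%N then expR x else 1.
have eqF w : expR (x * (hits B w)%:R) = \prod_i F i (w i).
  rewrite /F -big_mkcond /= /hits -sum1_card natr_sum mulr_sumr expR_sum.
  by apply: eq_big => [i|i _]; rewrite ?inE // mulr1.
under eq_bigr do rewrite eqF.
rewrite -(bigA_distr_bigA F) /=.
have sumF i : \sum_v F i v = Q.+1%:R * (if i \in B then 1 + p * (expR x - 1) else 1).
  rewrite /F; case: (i \in B) => /=; last by rewrite mulr1 sumr_const card_ord.
  rewrite (eq_bigr (fun v : 'I_Q.+1 => 1 + (v < q)%N%:R * (expR x - 1))); last first.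
    by move=> v _; case: (v < q)%N; rewrite ?mul0r ?addr0 // mul1r; ring.
  rewrite big_split /= -mulr_suml sumr_const card_ord [in RHS]mulrDr mulr1; congr (_ + _).
  rewrite mulrA /p mulrCA divff ?mulr1 ?pnatr_eq0 //; congr (_ * _).
  rewrite -natr_sum; congr (_%:R); rewrite -(big_mkord xpredT (fun i => (i < q)%N : nat)).
  have minE j : (\sum_(0 <= i < j) (i < q)%N = minn j q)%N.
    elim: j => [|j IH]; first by rewrite big_geq // min0n.
    by rewrite big_nat_recr //= IH; lia.
  by rewrite minE; apply/minn_idPr.
under eq_bigr do rewrite sumF.
rewrite big_split /= prodr_const -big_mkcond /= prodr_const; congr (_ * _).
by rewrite /N card_ffun card_ord natrX.
Qed.

Lemma sum_expR_hits_le B (x : R) : `|x| <= 1 / 4 ->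
  \sum_w expR (x * (hits B w)%:R) <= N * expR (p * #|B|%:R * (x + x ^+ 2)).
Proof.
move=> xl; rewrite sum_expR_hits ler_wpM2l //.
have p0 : 0 <= p by rewrite divr_ge0.
have p1 : p <= 1 by rewrite ler_pdivrMr ?mul1r ?ler_nat ?ltr0n.
have -> : p * #|B|%:R * (x + x ^+ 2) = p * (x + x ^+ 2) * #|B|%:R by ring.
rewrite expRM_natr; apply: lerXn2r; rewrite ?nnegrE ?expR_ge0 //.
  have := expR_gt0 x; nra.
apply: le_trans (expR_ge1Dx _); have := expR_le_quadratic xl; nra.
Qed.

Lemma markov_count (P : pred {ffun T -> 'I_Q.+1}) (f : {ffun T -> 'I_Q.+1} -> R) (y b : R) :
  (forall w, P w -> expR y <= f w) -> (forall w, 0 <= f w) ->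
  \sum_w f w <= N * expR b -> #|[set w | P w]|%:R <= N * expR (b - y).
Proof.
move=> Pf f0 le; rewrite expRB mulrA ler_pdivlMr ?expR_gt0 //; apply: le_trans le.
rewrite -sum1_card natr_sum mulr_suml big_mkcond /=; apply: ler_sum => w _.
by rewrite inE mul1r; case: ifP => [/Pf|].
Qed.

Variable d : R.
Hypotheses (d0 : 0 < d) (d1 : d <= 1 / 2).

(** The bound is stated for any [mu] above the mean, since the size of a closure is known only
    through an upper bound. *)
Lemma hits_upper B mu : p * #|B|%:R <= mu ->
  #|[set w | (1 + d) * mu < (hits B w)%:R]|%:R <= N * expR (- (d ^+ 2 * mu / 4)).
Proof.
(* The moment parameter is [x = d / 2], for which [x + x ^+ 2 - x * (1 + d) = - d ^+ 2 / 4]. *)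
move=> le; have -> : - (d ^+ 2 * mu / 4) =
    mu * (d / 2 + (d / 2) ^+ 2) - d / 2 * ((1 + d) * mu) by field.
apply: (markov_count (f := fun w => expR (d / 2 * (hits B w)%:R))).
- by move=> w lt; rewrite ler_expR ler_pM2l ?ltW // divr_gt0.
- by move=> w; apply: expR_ge0.
apply: le_trans (sum_expR_hits_le _ _) _.
  by rewrite ger0_norm; move: d0 d1; lra.
by rewrite ler_wpM2l // ler_expR ler_wpM2r //; move: d0; nra.
Qed.

Lemma hits_lower B :
  #|[set w | (hits B w)%:R < (1 - d) * (p * #|B|%:R)]|%:R <=
    N * expR (- (d ^+ 2 * (p * #|B|%:R) / 4)).
Proof.
set mu := p * _; have -> : - (d ^+ 2 * mu / 4) =
    mu * (- (d / 2) + (- (d / 2)) ^+ 2) - - (d / 2) * ((1 - d) * mu) by field.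
apply: (markov_count (f := fun w => expR (- (d / 2) * (hits B w)%:R))).
- by move=> w lt; rewrite ler_expR !mulNr lerN2 ler_pM2l ?ltW // divr_gt0.
- by move=> w; apply: expR_ge0.
apply: le_trans (sum_expR_hits_le _ _) _.
  by rewrite normrN ger0_norm; move: d0 d1; lra.
by [].
Qed.

End Chernoff.

(** * Concentration of the covering number under sampling *)

Section SampledMatroid.
Context {R : realType} {U : choiceType} {T : finType} {Q : nat}.
Variables (M : matroid U) (E : {fset U}) (sl : U -> T).
Hypothesis injs : {in E &, injective sl}.
Implicit Types (w : {ffun T -> 'I_Q.+1}) (A I : {fset U}).

Definition slots A := [set i in [seq sl x | x <- enum_fset A]]%SET.

Lemma card_slots A : A `<=` E -> #|slots A| = #|` A|.
Proof.
move=> AE; rewrite cardsE; have /card_uniqP -> : uniq [seq sl x | x <- enum_fset A].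
  rewrite map_inj_in_uniq ?fset_uniq // => x y xA yA.
  by apply: injs; apply: (fsubsetP AE).
by rewrite size_map.
Qed.

Lemma hits_slots q A w : A `<=` E -> hits q (slots A) w = #|` sampled sl q w A|.
Proof.
move=> AE; rewrite /hits -card_slots; last first.
  by apply: fsubset_trans AE; apply/fsubsetP => x; rewrite in_fset_sep => /andP[].
apply: eq_card => i; rewrite !inE; apply/andP/mapP.
  by move=> [/mapP[x xA ->] lt]; exists x; rewrite // in_fset_sep lt andbT.
by move=> [x]; rewrite in_fset_sep => /andP[xA lt] ->; split => //; apply: map_f.
Qed.

Variables (b : R) (D : {fset U}).
Hypotheses (DE : D `<=` E) (D0 : D != fset0) (b0 : 0 < b).
Hypothesis cover : forall A, A `<=` E -> #|` A|%:R <= b * (rk M A)%:R :> R.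
Hypothesis dense : #|` D|%:R = b * (rk M D)%:R :> R.

(** As [D] has density [b] and sampling does not increase its rank, the two conditions confine the
    covering number of the sample to between [(1 - d) * p * b] and [(1 + d) * p * b]. *)
Definition good_sample (p d : R) q w := 
  (forall A, A `<=` sampled sl q w E -> #|` A|%:R <= (1 + d) * p * b * (rk M A)%:R) /\
  (1 - d) * p * #|` D|%:R <= #|` sampled sl q w D|%:R.

Definition mclosure I := [fset x in E | rk M (x |` I) == rk M I].

Lemma rk_mclosure I : I `<=` E -> rk M (mclosure I) = rk M I.
Proof.
move=> IE; have IC : I `<=` mclosure I.
  apply/fsubsetP => x xI; rewrite in_fset_sep (fsubsetP IE) //=.
  by rewrite mem_fset1U.
rewrite -{1}(fsetUidPr _ _ IC); apply: rk_fsetU_span => x.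
by rewrite in_fset_sep => /andP[_ /eqP].
Qed.

Variables (q : nat) (d : R).
Hypotheses (qQ : (q <= Q.+1)%N) (d0 : 0 < d) (d1 : d <= 1 / 2).
Let p : R := q%:R / Q.+1%:R.
Let rho : R := expR (- (d ^+ 2 * (p * b) / 4)).
Let N : R := #|{ffun T -> 'I_Q.+1}|%:R.

Definition of_slots (J : {set T}) := [fset x in E | sl x \in J].

(** The first three conditions say that [J] is the slot set of a nonempty independent set, the last
    one that the closure of this set is hit too often. Sets of slots are used because they form a
    finite type over which to sum. *)
Definition overfull (J : {set T}) w :=
  (J != finset.set0) && (#|` of_slots J| == #|J|) && (rk M (of_slots J) == #|J|) &&
  ((1 + d) * (p * b * #|J|%:R) < (hits q (slots (mclosure (of_slots J))) w)%:R).

Definition underfull w := (hits q (slots D) w)%:R < (1 - d) * (p * #|slots D|%:R).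

(** The closure has rank [#|J|], hence at most [b * #|J|] elements. Chernoff's bound with mean at
    most [p * b * #|J|] contributes one factor [rho] per element of [J]. *)
Lemma card_overfull J : #|[set w | overfull J w]%SET|%:R <=
  (J != finset.set0)%:R * (N * rho ^+ #|J|).
Proof.
have c0 : #|[set w : {ffun T -> 'I_Q.+1} | false]%SET| = 0%N.
  by apply: eq_card0 => w; rewrite inE.
rewrite /overfull; case: (J != finset.set0) => /=; last first.
  by rewrite mul0r c0.
case: eqP => [cJ|_] /=; last first.
  by rewrite mul1r c0 mulr_ge0 // exprn_ge0 // expR_ge0.
case: eqP => [rJ|_] /=; last first.
  by rewrite mul1r c0 mulr_ge0 // exprn_ge0 // expR_ge0.
have JE : of_slots J `<=` E by apply/fsubsetP => x; rewrite in_fset_sep => /andP[].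
have CE : mclosure (of_slots J) `<=` E.
  by apply/fsubsetP => x; rewrite in_fset_sep => /andP[].
have p0 : 0 <= p by rewrite divr_ge0.
rewrite mul1r; apply: le_trans (@hits_upper R T Q q qQ d d0 d1 _ (p * b * #|J|%:R) _) _.
  rewrite card_slots // -mulrA ler_wpM2l //; apply: le_trans (cover CE) _.
  by rewrite rk_mclosure // rJ.
rewrite ler_wpM2l // /rho -expRM_natr ler_expR le_eqVlt; apply/orP; left.
by apply/eqP; field.
Qed.

(** A subset [A] of the sample lies in the sampled part of the closure of a basis [I] of [A], and
    [I] has the rank of [A]. So controlling the closures of independent sets controls all
    subsets. *)
Lemma good_sampleP w : ~~ underfull w -> (forall J, ~~ overfull J w) ->
  good_sample p d q w.
Proof.
move=> nu no; split; last first.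
  by move: nu; rewrite /underfull -leNgt hits_slots // card_slots // mulrA.
move=> A sA.
have AE : A `<=` E.
  by apply: fsubset_trans sA _; apply/fsubsetP => x; rewrite in_fset_sep => /andP[].
have [I [indI IA cI]] := rk_basis M A.
have IE := fsubset_trans IA AE.
have oI : of_slots (slots I) = I.
  apply/fsetP => x; rewrite in_fset_sep inE; apply/andP/idP.
    by move=> [xE /mapP[y yI /injs ->]] //; apply: (fsubsetP IE).
  by move=> xI; rewrite (fsubsetP IE) // map_f.
have [I0|/negbTE I0] := eqVneq (slots I) finset.set0.
  have cI0 : #|` I| = 0%N by rewrite -card_slots // I0 cards0.
  have := cover AE; rewrite -cI cI0 mulr0 => le; rewrite mulr0.
  exact: le.
have := no (slots I); rewrite /overfull oI I0 card_slots // eqxx rk_indep // eqxx /= -leNgt.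
have CE : mclosure I `<=` E by apply/fsubsetP => x; rewrite in_fset_sep => /andP[].
rewrite hits_slots // cI => le; rewrite -!mulrA in le *; apply: le_trans le.
rewrite ler_nat fsubset_leq_card //; apply/fsubsetP => x xA.
have := fsubsetP sA _ xA; rewrite !in_fset_sep => /andP[-> ->]; rewrite /= andbT.
have sxA : x |` I `<=` A by rewrite fsubUset fsub1set xA.
by rewrite eqn_leq (rk_mono M (fsubsetU1 x I)) andbT (rk_indep indI) cI rk_mono.
Qed.

Lemma card_bad_sample : exists Bad : {set {ffun T -> 'I_Q.+1}},
  (forall w, w \notin Bad -> good_sample p d q w) /\
  #|Bad|%:R <= N * (rho + ((1 + rho) ^+ #|T| - 1)).
Proof.
exists ([set w | underfull w] :|: \bigcup_J [set w | overfull J w])%SET; split.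
  move=> w; rewrite !inE negb_or => /andP[nu no]; apply: good_sampleP => // J.
  by apply: contra no => oJ; apply/bigcupP; exists J; rewrite ?inE.
have cU : #|[set w | underfull w]%SET|%:R <= N * rho.
  apply: le_trans (@hits_lower R T Q q qQ d d0 d1 (slots D)) _.
  rewrite ler_wpM2l // ler_expR lerN2 ler_wpM2r // ler_wpM2l ?sqr_ge0 //.
  rewrite ler_wpM2l ?divr_ge0 // card_slots // dense ler_peMr ?(ltW b0) //.
  rewrite ler1n lt0n; apply: contraNneq D0 => r0; rewrite -cardfs_eq0.
  by have := dense; rewrite r0 mulr0 => /eqP; rewrite pnatr_eq0.
have cO : #|\bigcup_J [set w | overfull J w]%SET|%:R <= N * ((1 + rho) ^+ #|T| - 1).
  apply: (@le_trans _ _ (\sum_J #|[set w | overfull J w]%SET|%:R)).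
    rewrite -natr_sum ler_nat; apply: (big_ind2 (fun (A : {set _}) v => #|A| <= v)%N) => //.
      by rewrite cards0.
    move=> A v A' v' le le'; apply: leq_trans (leq_add le le').
    by rewrite cardsU leq_subr.
  apply: le_trans (ler_sum _ (fun J _ => card_overfull J)) _.
  under eq_bigr do rewrite mulrCA.
  rewrite -mulr_sumr ler_wpM2l //.
  (* The binomial theorem evaluates the union bound; removing the empty [J] accounts for the
     [- 1]. *)
  have : (1 + rho) ^+ #|T| = \sum_(J : {set T}) rho ^+ #|J|.
    have -> : (1 + rho) ^+ #|T| = \prod_(i : T) (rho + 1) by rewrite prodr_const addrC.
    rewrite (bigA_distr _ _ (fun=> rho) (fun=> 1)) /=; apply: eq_bigr => J _.
    by rewrite -big_mkcond prodr_const.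
  rewrite (bigD1 finset.set0) //= cards0 expr0 => ->; rewrite addrAC subrr add0r.
  rewrite [leRHS]big_mkcond /=; apply: ler_sum => J _.
  by case: eqP; rewrite ?mul0r ?mul1r.
rewrite mulrDr; apply: le_trans (lerD cU cO); rewrite -natrD ler_nat.
by rewrite cardsU leq_subr.
Qed.

End SampledMatroid.

(** * The seed as a uniformly distributed natural number *)

Section UniformNat.
Context {R : realType} (N : nat).

(** A normalized sum of Dirac measures on [nat], where every set is measurable; seeds are recovered
    from numbers through an enumeration of the finite seed space. *)
Definition uniform_nat : set nat -> \bar R :=
  mscale (N.+1%:R^-1)%:nng (msum (fun i => \d_i) N.+1).

HB.instance Definition _ := Measure.on uniform_nat.

Lemma uniform_natE (A : set nat) :
  uniform_nat A = ((N.+1%:R^-1 * \sum_(i < N.+1) (\1_A (i : nat))) : R)%:E.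
Proof.
rewrite /uniform_nat /mscale /= /msum EFinM; congr (_ * _)%E.
by rewrite -sumEFin; apply: eq_bigr.
Qed.

Lemma uniform_nat_setT : uniform_nat setT = 1%E.
Proof.
rewrite uniform_natE (eq_bigr (fun=> 1)); last by move=> i _; rewrite indicT.
by rewrite sumr_const card_ord mulVf // pnatr_eq0.
Qed.

HB.instance Definition _ := Measure_isProbability.Build _ _ _ uniform_nat uniform_nat_setT.

End UniformNat.

Definition decode (W : finType) (w0 : W) (i : nat) := nth w0 (enum W) i.

Lemma uniform_nat_ge (R : realType) (W : finType) (w0 : W) (Bad : {set W})
    (A : set nat) (x : R) :
  (forall i, decode w0 i \notin Bad -> A i) -> #|Bad|%:R <= #|W|%:R * x ->
  ((1 - x)%:E <= uniform_nat (R := R) #|W|.-1 A)%E.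
Proof.
move=> BadA le; rewrite uniform_natE lee_fin.
have W0 : (0 < #|W|)%N by apply/card_gt0P; exists w0.
rewrite prednK // mulrC ler_pdivlMr ?ltr0n //.
apply: (@le_trans _ _ (\sum_(i < #|W|) (decode w0 i \notin Bad)%:R)); last first.
  apply: ler_sum => i _; rewrite indicE ler_nat.
  by case: (boolP (decode w0 i \in Bad)) => //= /BadA iA; rewrite mem_set.
have -> : \sum_(i < #|W|) (decode w0 i \notin Bad)%:R = \sum_(w : W) (w \notin Bad)%:R :> R.
  rewrite -(big_mkord xpredT (fun i => (decode w0 i \notin Bad)%:R)) cardE.
  by rewrite -(big_nth w0 xpredT (fun w => (w \notin Bad)%:R)) big_enum.
have -> : \sum_(w : W) (w \notin Bad)%:R = #|W|%:R - #|Bad|%:R :> R.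
  rewrite -natr_sum -big_mkcond sum1_card.
  rewrite -(cardC (mem Bad)) natrD addrAC subrr add0r; congr (_%:R).
lra.
Qed.

(** * The fractional covering number *)

Section CoveringNumber.
Context {R : realType} {U : choiceType} (M : matroid U).

Let beta := fractional_covering_number R M.

Lemma le_covering_number (A : {fset U}) : A `<=` ground M -> A != fset0 ->
  ((#|` A|%:R)%:E / ((rk M A)%:R)%:E <= beta)%E.
Proof.
rewrite -fpowersetE /beta /fractional_covering_number.
change (A \in fpowerset (ground M)) with (A \in enum_fset (fpowerset (ground M))).
elim: (enum_fset _) => // B s IH; rewrite inE big_cons => /orP[/eqP <-|As] A0.
  by rewrite A0 le_max lexx.
by case: ifP => _; rewrite ?le_max IH ?orbT.
Qed.

Lemma covering_number_attained : ground M != fset0 ->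
  exists D, [/\ D `<=` ground M, D != fset0 &
    beta = ((#|` D|%:R)%:E / ((rk M D)%:R)%:E)%E].
Proof.
move=> M0; have ge0 (A : {fset U}) : (0 <= (#|` A|%:R : R)%:E / ((rk M A)%:R)%:E)%E.
  by rewrite mule_ge0 ?inve_ge0 // lee_fin.
have [|//] : beta = 0%E \/ exists D, [/\ D `<=` ground M, D != fset0 &
    beta = ((#|` D|%:R)%:E / ((rk M D)%:R)%:E)%E].
  rewrite {1 2}/beta /fractional_covering_number big_seq_cond.
  apply: (big_ind (fun v => v = 0%E \/ exists D, [/\ D `<=` ground M, D != fset0 &
    v = ((#|` D|%:R)%:E / ((rk M D)%:R)%:E)%E])).
  - by left.
  - by move=> x y Px Py; rewrite /maxe; case: ifP.
  - by move=> A /andP[]; rewrite fpowersetE => AE A0; right; exists A.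
(* If the maximum is the start value [0], the ratio of the whole ground set, nonnegative and at most
   [beta], is [0] too. *)
move=> b0; exists (ground M); split => //.
apply/eqP; rewrite eq_le; apply/andP; split; last exact: le_covering_number.
by rewrite b0.
Qed.

Lemma covering_number_loop x : x \in ground M -> rk M [fset x] = 0 -> beta = +oo%E.
Proof.
move=> xM r0; have := @le_covering_number [fset x].
rewrite fsub1set xM r0 cardfs1 inve0 mul1e leye_eq => /(_ isT)/(_ _)/eqP; apply.
by rewrite -cardfs_eq0 cardfs1.
Qed.

Lemma covering_number_finite : ground M != fset0 ->
  {in ground M, forall x, rk M [fset x] != 0} ->
  exists b : R, exists D : {fset U}, [/\ 0 < b, b <= #|` ground M|%:R & beta = b%:E]%R /\
    [/\ D `<=` ground M, D != fset0, #|` D|%:R = b * (rk M D)%:R &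
      forall A, A `<=` ground M -> #|` A|%:R <= b * (rk M A)%:R]%R.
Proof.
move=> M0 noloop; have [D [DE D0 eqb]] := covering_number_attained M0.
have rk0 A : A `<=` ground M -> A != fset0 -> (0 < rk M A)%N.
  move=> AE /fset0Pn[x xA]; have := noloop x (fsubsetP AE _ xA).
  rewrite -lt0n => /leq_trans; apply; apply: rk_mono.
  by rewrite fsub1set.
have finE A : A `<=` ground M -> A != fset0 ->
    ((#|` A|%:R : R)%:E / ((rk M A)%:R)%:E = (#|` A|%:R / (rk M A)%:R)%:E)%E.
  by move=> AE A0; rewrite inver pnatr_eq0 eqn0Ngt rk0 // -EFinM.
exists (#|` D|%:R / (rk M D)%:R)%R, D; split; split => //.
- by rewrite divr_gt0 // ltr0n ?cardfs_gt0 ?rk0.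
- rewrite ler_pdivrMr ?ltr0n ?rk0 // -natrM ler_nat.
  by apply: leq_trans (fsubset_leq_card DE) _; rewrite leq_pmulr ?rk0.
- by rewrite eqb finE.
- by rewrite divfK // pnatr_eq0 -lt0n rk0.
move=> A AE; have [->|A0] := eqVneq A fset0.
  by rewrite cardfs0 mulr_ge0 ?divr_ge0.
have := le_covering_number AE A0; rewrite eqb !finE // lee_fin.
by rewrite ler_pdivrMr // ltr0n rk0.
Qed.

End CoveringNumber.

(** * Selection of the level *)

Section LevelSelection.
Context {R : realType} {U : choiceType} {n h : nat}.
Variables (k : nat) (K d : R) (w : {ffun 'I_n.+1 -> 'I_((2 ^ h).-1.+1)}).
Variables (M : matroid U) (E : {fset U}) (sl : U -> 'I_n.+1) (b : R) (D : {fset U}).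
Hypothesis injs : {in E &, injective sl}.
Hypotheses (DE : (D `<=` E)%fset) (D0 : D != fset0) (b0 : 0 < b).
Hypothesis cover : forall A, (A `<=` E)%fset -> #|` A|%:R <= b * (rk M A)%:R :> R.
Hypothesis dense : #|` D|%:R = b * (rk M D)%:R :> R.
Hypotheses (d0 : 0 < d) (d1 : d <= 1 / 16) (K0 : 0 < K) (k0 : (0 < k)%N).
Hypotheses (En : (#|` E| <= n)%N) (kK : 4 * K * ln n%:R / d ^+ 2 <= k%:R).

Let S j := sample w sl j E.
Let m j := min_load k (packing (rk M) sl (fun=> 0%N) (S j) k) (S j).

Definition good_level j := good_sample M E sl b D ((2 ^+ j)^-1) d (2 ^ (h - j))%N w.

(** Level 0 keeps every element whatever the seed. This covers small [b], for which no concentration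
    is available. *)
Lemma good_level0 : good_level 0.
Proof.
have Q0 : (0 < 2 ^ h)%N by rewrite expn_gt0.
have all A : sampled sl (2 ^ (h - 0))%N w A = A.
  apply/fsetP => x; rewrite in_fset_sep subn0 -[X in (_ < X)%N](prednK Q0).
  by rewrite ltn_ord andbT.
split; rewrite all ?invr1 ?expr0 ?invr1 ?mulr1.
  move=> A AE; apply: le_trans (cover AE) _.
  by rewrite -mulrA ler_peMl ?lerDl ?(ltW d0) // mulr_ge0 // ltW.
by rewrite ler_piMl // gerBl ltW.
Qed.

Lemma sample_sub j : (S j `<=` E)%fset.
Proof. by apply/fsubsetP => x; rewrite in_fset_sep => /andP[]. Qed.

Lemma rkD0 : 0 < (rk M D)%:R :> R.
Proof.
rewrite -(pmulr_rgt0 _ b0) -dense ltr0n cardfs_gt0; exact: D0.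
Qed.

(** Double counting on the sampled part of [D], which keeps about the fraction [2 ^- j] of the
    elements while its rank does not exceed that of [D]. *)
Lemma level_load_le j : good_level j -> (m j)%:R * ((1 - d) * (b / 2 ^+ j)) <= k%:R.
Proof.
move=> [_ low]; rewrite -(ler_pM2r rkD0).
pose A := sampled sl (2 ^ (h - j))%N w D.
have AS : (A `<=` S j)%fset.
  apply/fsubsetP => x; rewrite !in_fset_sep => /andP[xD ->]; rewrite andbT.
  exact: (fsubsetP DE).
have injS : {in S j &, injective sl}.
  by move=> x y xS yS; apply: injs; apply: (fsubsetP (sample_sub j)).
have := min_load_upper M injS k AS; rewrite -(ler_nat R) !natrM => le.
have rkA : (rk M A)%:R <= (rk M D)%:R :> R.
  by rewrite ler_nat rk_mono //; apply/fsubsetP => x; rewrite in_fset_sep => /andP[].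
apply: (@le_trans _ _ ((m j)%:R * #|` A|%:R)).
  rewrite -mulrA ler_wpM2l //; apply: le_trans low; rewrite dense.
  by rewrite le_eqVlt; apply/orP; left; apply/eqP; ring.
by apply: le_trans le _; rewrite ler_wpM2l.
Qed.

Lemma level_load_ge j : good_level j -> b / 2 ^+ j <= 2 * K ->
  (1 - 3 * d) * k%:R <= (m j)%:R * (b / 2 ^+ j).
Proof.
move=> [up low] bK.
have p0 : 0 < b / 2 ^+ j by rewrite divr_gt0 // exprn_gt0.
have injS : {in S j &, injective sl}.
  by move=> x y xS yS; apply: injs; apply: (fsubsetP (sample_sub j)).
have Sn : (#|` S j| <= n)%N by apply: leq_trans En; apply/fsubset_leq_card/sample_sub.
(* A good sample contains part of [D], so the least load is that of an actual element. *)
have S0 : S j != fset0.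
  apply: contraTneq low => S0; rewrite -ltNge.
  have -> : sampled sl (2 ^ (h - j))%N w D = fset0.
    apply/eqP; rewrite -fsubset0 -S0; apply/fsubsetP => x; rewrite !in_fset_sep.
    by move=> /andP[xD ->]; rewrite (fsubsetP DE).
  rewrite cardfs0 -mulrA mulr_gt0 //; first by move: d1; lra.
  by rewrite mulr_gt0 ?invr_gt0 ?exprn_gt0 // ltr0n cardfs_gt0.
have b'0 : 0 < (1 + d) * (b / 2 ^+ j) by rewrite mulr_gt0 // addr_gt0.
have := @min_load_lower R U _ M sl (S j) injS d _ d0 b'0 _ k n S0 Sn.
rewrite -/(m j) => /(_ _) le.
have {}le : k%:R / ((1 + d) * ((1 + d) * (b / 2 ^+ j))) <= (m j)%:R + ln n%:R / d.
  apply: le => A AS; apply: le_trans (up A AS) _.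
  by rewrite le_eqVlt; apply/orP; left; apply/eqP; ring.
set y := b / 2 ^+ j in bK p0 b'0 le *; clearbody y.
move: le bK kK d0 d1 K0; set L := ln _; set mm := (m j)%:R; set kk := k%:R.
have kk0 : 0 < kk by rewrite /kk ltr0n.
clearbody L mm kk => le bK kK' d0' d1' K0'.
(* The number of bases is chosen for this estimate: [y <= 2 * K] and [4 * K * L <= kk * d ^+ 2]. *)
have L1 : L / d * y <= d * kk / 2.
  have : 4 * K * L <= kk * d ^+ 2 by rewrite -ler_pdivrMr // exprn_gt0.
  move=> le4; rewrite mulrAC ler_pdivrMr //.
  have [L0|L0] := leP 0 L; nra.
have {}le : kk <= (mm * y + L / d * y) * (1 + d) ^+ 2.
  have dp : 0 < 1 + d by rewrite addr_gt0.
  move: le; rewrite ler_pdivrMr ?mulr_gt0 //.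
  by move=> /le_trans; apply; rewrite le_eqVlt; apply/orP; left; apply/eqP; ring.
have le2 : kk <= (mm * y + d * kk / 2) * (1 + d) ^+ 2.
  by apply: le_trans le _; rewrite ler_wpM2r ?sqr_ge0 // lerD2l.
have q0 : 0 < (1 + d) ^+ 2 by rewrite exprn_gt0 // addr_gt0.
rewrite -(ler_pM2r q0).
(* One factor [1 + d] stems from the sampling, the other from the multiplicative weights bound, and
   [d / 2] from its additive error; together they cost at most [3 * d]. *)
have : (1 - 3 * d + d / 2) * (1 + d) ^+ 2 <= 1 by nra.
nra.
Qed.

Lemma level_load_canonical j : (j <= h)%N ->
  level_load k w (canonical_state k w (rk M) E sl) j = m j.
Proof.
move=> jh; rewrite /level_load /canonical_state /cur_packings /cur_slot /cur_ground (nth_map 0%N) ?size_iota // nth_iota //.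
Qed.

Hypotheses (noloop : {in E, forall x, rk M [fset x]%fset != 0%N}).
Hypotheses (bn : b <= n%:R) (nh : (n <= 2 ^ h)%N) (K4 : 4 <= K).
Hypothesis good : forall j, (j <= h)%N -> K / 4 <= b / 2 ^+ j -> good_level j.

Lemma output_canonical (eps : R) : d = eps / 8 -> eps < 1 / 2 ->
  ((1 - eps)%:E * b%:E <= output_state k K w (canonical_state k w (rk M) E sl) <=
   (1 + eps)%:E * b%:E)%E.
Proof.
move=> deps eps1.
(* Take the least [j] with [b / 2 ^+ j <= K / 2]. Unless [j = 0], minimality gives
   [b / 2 ^+ i >= K / 4] for all [i <= j], so these levels are good. Level [j] passes the test, so
   the selected level is at most [j], and levels beyond [j] need not be good. *)
have [j [jh gj bj]] : exists j, [/\ (j <= h)%N, forall i, (i <= j)%N -> good_level i &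
    b / 2 ^+ j <= K / 2].
  have [small|big] := leP b (K / 2).
    exists 0%N; rewrite expr0 divr1; split => // i; rewrite leqn0 => /eqP ->.
    exact: good_level0.
  have ex : exists j, b / 2 ^+ j <= K / 2.
    exists h; rewrite ler_pdivrMr ?exprn_gt0 //; apply: le_trans bn _.
    have : n%:R <= 2 ^+ h :> R by rewrite -natrX ler_nat.
    by have : 0 <= 2 ^+ h :> R by []; move: K4; nra.
  case: (ex_minnP ex) => -[|j] bj minj; first by move: bj big; rewrite expr0 divr1; lra.
  have pj i : (i <= j.+1)%N -> K / 4 <= b / 2 ^+ i.
    move=> ij; apply: (@le_trans _ _ (b / 2 ^+ j.+1)).
      have : K / 2 < b / 2 ^+ j by rewrite ltNge; apply/negP => /minj; rewrite ltnn.
      by rewrite exprS invfM mulrA; lra.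
    by rewrite ler_wpM2l ?(ltW b0) // lef_pV2 ?posrE ?exprn_gt0 // ler_weXn2l // ler1n.
  have jh : (j.+1 <= h)%N.
    apply: minj; rewrite ler_pdivrMr ?exprn_gt0 //; apply: le_trans bn _.
    have : n%:R <= 2 ^+ h :> R by rewrite -natrX ler_nat.
    by have : 0 <= 2 ^+ h :> R by []; move: K4; nra.
  exists j.+1; split => // i ij; apply: good; last exact: pj.
  exact: leq_trans ij jh.
have sel i : (i <= h)%N -> (k%:R <= K * (level_load k w (canonical_state k w (rk M) E sl) i)%:R)
    = (k%:R <= K * (m i)%:R).
  by move=> ih; rewrite level_load_canonical.
have kR : 0 < k%:R :> R by rewrite ltr0n.
have selj : k%:R <= K * (m j)%:R.
  have := level_load_ge (gj j (leqnn j)); move=> /(_ _) ge.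
  have {}ge : (1 - 3 * d) * k%:R <= (m j)%:R * (b / 2 ^+ j).
    by apply: ge; move: bj K0; lra.
  have : (m j)%:R * (b / 2 ^+ j) <= (m j)%:R * (K / 2) by rewrite ler_wpM2l.
  by move: ge kR d1; nra.
set s := canonical_state k w (rk M) E sl in sel *.
have loops : cur_loops s = fset0.
  apply/fsetP => x; rewrite in_fset_sep; apply/negbTE/negP => /andP[/noloop].
  by move=> /negbTE ->.
have gr : (cur_ground s == fset0) = false.
  by apply: contraNF D0 => /eqP E0; rewrite -fsubset0 -E0.
rewrite /output_state loops eqxx gr.
set P := fun j => _; set i := find P _.
rewrite [X in (_ <= X <= _)%E]/=.
have ij : (i <= j)%N.
  rewrite leqNgt; apply/negP => /(before_find 0%N); rewrite nth_iota //.
  by rewrite /P ?add0n sel // selj.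
have ih : (i <= h)%N := leq_trans ij jh.
have Pi : k%:R <= K * (m i)%:R.
  have := nth_find 0%N (_ : has P (iota 0 h.+1)); rewrite -/i nth_iota // /P ?add0n sel //.
  by apply; rewrite has_find size_iota.
rewrite /s level_load_canonical //.
have gi := gj i ij; have := level_load_le gi; have ge := level_load_ge gi.
have mi0 : 0 < (m i)%:R :> R.
  by rewrite -(pmulr_rgt0 _ K0); apply: lt_le_trans Pi.
have q0 : 0 < 2 ^+ i :> R by rewrite exprn_gt0.
have b'0 : 0 < b / 2 ^+ i by rewrite divr_gt0.
move: ge; set y := b / 2 ^+ i in b'0 *.
have -> : b = y * 2 ^+ i by rewrite /y divfK // gt_eqF.
set z := 2 ^+ i in q0 *; clearbody y z => ge le.
rewrite -!EFinM !lee_fin !mulrA !(ler_pM2r q0).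
(* The lower bound on the load presupposes a bound on [y], which depends on the unknown [b]. The
   passed test, combined with the upper bound on the load, supplies it. *)
have yK : y <= 2 * K.
  have : (1 - d) * y <= K.
    rewrite -(ler_pM2l mi0) mulrA; apply: le_trans (_ : k%:R <= _).
      by apply: le_trans le; rewrite mulrA.
    by rewrite mulrC.
  by move: b'0 d1; nra.
have {}ge := ge yK.
rewrite ler_pdivrMr // ler_pdivlMr //.
move: le ge kR mi0 b'0 d0 d1 eps1; rewrite deps.
move: (m i)%:R (k%:R : R) => mm kk le ge kk0 mm0 y0 e0 e1 e2.
have my0 : 0 < mm * y by rewrite mulr_gt0.
apply/andP; split; first by nra.
have : kk <= (1 + eps) * ((1 - 3 * (eps / 8)) * kk).
  have : 1 <= (1 + eps) * (1 - 3 * (eps / 8)) by nra.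
  by nra.
by nra.
Qed.

End LevelSelection.

Lemma covering_number_empty (R : realType) (U : choiceType) (M : matroid U) :
  ground M = fset0 -> fractional_covering_number R M = 0%E.
Proof.
move=> M0; rewrite /fractional_covering_number big_seq_cond.
apply: (big_ind (fun v => v = 0%E)) => // [x y -> ->|A /andP[]].
  by rewrite maxxx.
by rewrite M0 fpowersetE fsubset0 => ->.
Qed.

Lemma expr1D_sub1_le (R : realType) (x : R) n : 0 <= x -> n.+1%:R * x <= 1 / 4 ->
  x + ((1 + x) ^+ n.+1 - 1) <= (2 * n + 3)%:R * x.
Proof.
move=> x0 le.
have : (1 + x) ^+ n.+1 <= expR (x * n.+1%:R).
  by rewrite expRM_natr lerXn2r ?nnegrE ?expR_ge0 ?expR_ge1Dx // addr_ge0.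
have := @expR_le_quadratic R (x * n.+1%:R).
have y0 : 0 <= x * n.+1%:R by rewrite mulr_ge0.
rewrite ger0_norm // mulrC => /(_ le) e1 e2.
have -> : (2 * n + 3)%:R * x = 2 * (n.+1%:R * x) + x.
  by rewrite -(natr1 n) natrD natrM; ring.
move: le y0 e1 e2; rewrite [x * _]mulrC; set y := n.+1%:R * x; nra.
Qed.

Lemma level_fraction (R : realType) h j : (j <= h)%N ->
  (2 ^ (h - j))%:R / (2 ^ h).-1.+1%:R = (2 ^+ j)^-1 :> R.
Proof.
move=> jh; rewrite prednK ?expn_gt0 // -{2}(subnK jh) expnD natrM invfM mulrA.
by rewrite divff ?mul1r ?natrX // expf_eq0 pnatr_eq0 andbF.
Qed.

(** * Choice of the parameters *)

Section BadSeeds.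
Context {R : realType} {U : choiceType}.
Variables (c eps : R) (n e : nat).
Hypotheses (c1 : 1 <= c) (n2 : (1 < n)%N) (eps0 : 0 < eps) (eps1 : eps < 1 / 2).

(** The exponent [a] in the failure probability [n ^ - a]: [c] is required, [e] pays for [n ^ e]
    points in time, and [4] for the union over levels and independent sets, as
    [h.+1 * (2 * n + 3) <= n ^ 4]. *)
Definition confidence : R := c + e%:R + 4.
Definition slack : R := eps / 8.
(** Chosen so that [d ^+ 2 * (K / 4) / 4 = a * ln n]: a sampled covering number of at least [K / 4]
    makes the Chernoff factor at most [n ^ - a]. *)
Definition level_threshold : R := 16 * confidence * ln n%:R / slack ^+ 2.
Definition num_bases := (Num.truncn (4 * level_threshold * ln n%:R / slack ^+ 2)).+1.
Definition num_levels := up_log 2 n.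

Let a := confidence.
Let d := slack.
Let K := level_threshold.
Let k := num_bases.
Let h := num_levels.
Let W := {ffun 'I_n.+1 -> 'I_((2 ^ h).-1.+1)}.
Let rho : R := expR (- (a * ln n%:R)).

Lemma expR_half_le2 : expR (1 / 2) <= 2 :> R.
Proof.
have := expR_ge1Dx (- (1 / 2) : R); rewrite expRN => le.
rewrite -[leLHS]invrK -[leRHS]invrK lef_pV2 ?posrE ?invr_gt0 ?expR_gt0 //; lra.
Qed.

Lemma ln_ge_half : 1 / 2 <= ln n%:R :> R.
Proof.
have n0 : 0 < n%:R :> R by rewrite ltr0n ltnW.
rewrite -ler_expR lnK ?posrE //; apply: le_trans expR_half_le2 _.
by rewrite ler_nat.
Qed.

Let a5 : 5 <= a.
Proof. by rewrite /a /confidence; have := ler0n R e; move: c1; lra. Qed.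

Let d0 : 0 < d.
Proof. by rewrite /d /slack divr_gt0. Qed.

Let d16 : d <= 1 / 16.
Proof. by rewrite /d /slack; move: eps1; lra. Qed.

Let K4 : 4 <= K.
Proof.
rewrite /K /level_threshold ler_pdivlMr ?exprn_gt0 //.
have := ln_ge_half; move: a5 d16 d0; rewrite -/a -/d; nra.
Qed.

Let kK : 4 * K * ln n%:R / d ^+ 2 <= k%:R.
Proof. by rewrite ltW // /k /num_bases truncnS_gt. Qed.

Let nh : (n <= 2 ^ h)%N.
Proof. exact: up_logP. Qed.

Let hn : (h < n)%N.
Proof.
rewrite -(prednK (ltnW n2)) ltnS up_log_min //.
by rewrite -{1}(prednK (ltnW n2)) ltn_expl.
Qed.

Let rhoE : rho = expR (- ((c + e%:R) * ln n%:R)) / n%:R ^+ 4.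
Proof.
have n0 : 0 < n%:R :> R by rewrite ltr0n ltnW.
rewrite /rho /a /confidence mulrDl opprD expRD; congr (_ * _).
by rewrite expRN mulrC expRM_natr lnK ?posrE.
Qed.

Let rho_small : n.+1%:R * rho <= 1 / 4.
Proof.
have n0 : 0 < n%:R :> R by rewrite ltr0n ltnW.
have le : rho <= (n%:R ^+ 5)^-1.
  have -> : n%:R ^+ 5 = expR (ln n%:R * 5%:R) :> R by rewrite expRM_natr lnK ?posrE.
  rewrite /rho -expRN ler_expR lerN2 [leLHS]mulrC ler_wpM2r //.
  by apply: le_trans ln_ge_half; rewrite divr_ge0.
apply: le_trans (ler_wpM2l (ler0n _ _) le) _.
rewrite ler_pdivrMr ?exprn_gt0 // mulrAC ler_pdivlMr // mul1r.
rewrite -natrX -natrM ler_nat (expnS n 4).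
have : (2 ^ 4 <= n ^ 4)%N by rewrite leq_exp2r.
by move: n2; move: (n ^ 4)%N => m; nia.
Qed.

Let total_small : h.+1%:R * ((2 * n + 3)%:R * rho) <= expR (- ((c + e%:R) * ln n%:R)).
Proof.
have n0 : 0 < n%:R :> R by rewrite ltr0n ltnW.
rewrite rhoE; set x := expR _.
have -> : h.+1%:R * ((2 * n + 3)%:R * (x / n%:R ^+ 4)) =
          x * (h.+1%:R * (2 * n + 3)%:R / n%:R ^+ 4) by ring.
rewrite ler_piMr ?expR_ge0 // ler_pdivrMr ?exprn_gt0 // mul1r -natrX -natrM ler_nat.
apply: (@leq_trans (n * (2 * n + 3))%N); first by rewrite leq_mul2r hn orbT.
rewrite (expnD n 2 2); have : (2 ^ 2 <= n ^ 2)%N by rewrite leq_exp2r.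
by rewrite -mulnn; move: n2; nia.
Qed.

(** The conditions on [j] stand inside the conclusion so that a set of bad seeds can be chosen for
    every [j]; it is empty for the levels that do not matter. *)
Lemma bad_level (M : matroid U) E (sl : U -> 'I_n.+1) (b : R) D j :
  {in E &, injective sl} -> (D `<=` E)%fset -> D != fset0 -> 0 < b ->
  (forall A, (A `<=` E)%fset -> #|` A|%:R <= b * (rk M A)%:R) ->
  #|` D|%:R = b * (rk M D)%:R ->
  exists Bad : {set W}, (forall w, w \notin Bad -> (j <= h)%N -> K / 4 <= b / 2 ^+ j ->
     good_level d w M E sl b D j) /\
   #|Bad|%:R <= #|{: W}|%:R * ((2 * n + 3)%:R * rho).
Proof.
move=> injs DE D0 b0 cover dense.
have [/andP[jh bj]|no] := boolP ((j <= h)%N && (K / 4 <= b / 2 ^+ j)); last first.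
  exists finset.set0; split.
    by move=> w _ jh bj; rewrite jh bj in no.
  by rewrite cards0 !mulr_ge0 ?expR_ge0.
have qQ : (2 ^ (h - j) <= (2 ^ h).-1.+1)%N.
  by rewrite prednK ?expn_gt0 // leq_exp2l // leq_subr.
have d2 : d <= 1 / 2 by move: d16; lra.
have [Bad [BadP cB]] := card_bad_sample injs DE D0 b0 cover dense qQ d0 d2.
exists Bad; split => [w /BadP + _ _|]; first by rewrite level_fraction.
apply: le_trans cB _; rewrite ler_wpM2l // level_fraction // card_ord.
set r := expR _.
have rr : r <= rho.
  rewrite /r /rho ler_expR lerN2.
  have : a * ln n%:R = d ^+ 2 * (K / 4) / 4.
    by rewrite /K /level_threshold -/a -/d; field; rewrite gt_eqF.
  move=> ->; rewrite ler_pM2r // ler_pM2l ?exprn_gt0 //.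
  by rewrite [leRHS]mulrC.
have r0 : 0 <= r := expR_ge0 _.
have rho0 : 0 <= rho := expR_ge0 _.
apply: le_trans (expr1D_sub1_le rho0 rho_small).
by rewrite lerD // lerB // lerXn2r ?nnegrE ?addr_ge0 // lerD2l.
Qed.

Lemma bad_seeds (M : matroid U) (sl : U -> 'I_n.+1) :
  (#|` ground M| <= n)%N -> {in ground M &, injective sl} ->
  let beta := fractional_covering_number R M in
  exists Bad : {set W}, (forall w, w \notin Bad ->
     let est := output_state k K w (canonical_state k w (rk M) (ground M) sl) in
     ((1 - eps)%:E * beta <= est <= (1 + eps)%:E * beta)%E) /\
   #|Bad|%:R <= #|{: W}|%:R * expR (- ((c + e%:R) * ln n%:R)).
Proof.
move=> Mn injs /=.
have [M0|M0] := eqVneq (ground M) fset0.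
  exists finset.set0; split; last by rewrite cards0 mulr_ge0 ?expR_ge0.
  move=> w _; rewrite (covering_number_empty R M0) !mule0 /output_state M0 eqxx.
  rewrite ifF ?lexx //; apply/negbTE; rewrite negbK; apply/eqP/fsetP => x.
  by rewrite in_fset_sep.
have [/hasP[x xM /eqP rx]|/hasPn noloop] := boolP (has (fun x => rk M [fset x]%fset == 0%N) (ground M)).
  exists finset.set0; split; last by rewrite cards0 mulr_ge0 ?expR_ge0.
  move=> w _; rewrite (@covering_number_loop R U M x xM rx) /output_state ifT.
    by rewrite !gt0_muley ?lte_fin //; move: eps0 eps1; lra.
  by apply/fset0Pn; exists x; rewrite in_fset_sep; apply/andP; split => //; apply/eqP.
have [b [D [[b0 bM ->] [DE D0 dense cover]]]] := @covering_number_finite R U M M0 noloop.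
have [Bad BadP] := choice (fun j => bad_level j injs DE D0 b0 cover dense).
exists (\bigcup_(j < h.+1) Bad j)%SET; split; last first.
  apply: (@le_trans _ _ (#|{: W}|%:R * (h.+1%:R * ((2 * n + 3)%:R * rho)))); last first.
    by rewrite ler_wpM2l.
  apply: (@le_trans _ _ (\sum_(j < h.+1) #|Bad j|%:R)).
    rewrite -natr_sum ler_nat; apply: (big_ind2 (fun (A : {set _}) v => #|A| <= v)%N) => //.
      by rewrite cards0.
    move=> A v A' v' le le'; apply: leq_trans (leq_add le le').
    by rewrite cardsU leq_subr.
  apply: (@le_trans _ _ (\sum_(j < h.+1) #|{: W}|%:R * ((2 * n + 3)%:R * rho))).
    by apply: ler_sum => j _; exact: (BadP j).2.
  by rewrite sumr_const card_ord -[leLHS]mulr_natl mulrCA.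
move=> w nBad; apply: (@output_canonical R U n h k K d w M _ sl b D) => //.
- by apply: lt_le_trans K4.
- by apply: le_trans bM _; rewrite ler_nat.
move=> j jh; apply: (BadP j).1 => //; apply: contra nBad => wB.
by apply/bigcupP; exists (Ordinal (jh : (j < h.+1)%N)).
Qed.

(** The cost is [(h.+1 * k) ^ 2 + 1], as bisection takes [h.+1] steps. The constant [64 ^+ 3] is
    [4 * 16 * 8 ^ 4], from the definitions of [k], [K] and [d]. With [z] as below the cost is at
    most [(12 * z) ^ 2 + 1], and [z >= 1 / 2] turns [1] into [4 * z ^ 2], whence [148 = 144 + 4]. *)
Lemma step_cost_le : (step_cost num_levels num_bases num_levels.+1)%:R <=
  148 * (64 ^+ 3 * (c + e%:R + 4)) ^+ 2 * ln n%:R ^+ 6 / eps ^+ 8.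
Proof.
have l0 := ln_ge_half.
set l := ln n%:R in l0 *.
have h6 : h.+1%:R <= 6 * l.
  have n0 : 0 < n%:R :> R by rewrite ltr0n ltnW.
  have hp : (2 ^ h.-1 < n)%N by apply: up_log_gtn.
  (* From [2 ^ h.-1 < n] and [expR (1 / 2) <= 2]. The remaining two levels are absorbed by [4 * l],
     as [l >= 1 / 2]. *)
  have : h.-1%:R * (1 / 2) <= l.
    rewrite -ler_expR /l lnK ?posrE // mulrC expRM_natr.
    apply: (@le_trans _ _ (2 ^+ h.-1)); last by rewrite -natrX ler_nat ltnW.
    by rewrite lerXn2r ?nnegrE ?expR_ge0 ?expR_half_le2.
  have : h.+1%:R <= h.-1%:R + 2%:R :> R by rewrite -natrD ler_nat; lia.
  by move: l0; lra.
have e4 : 0 < eps ^+ 4 by rewrite exprn_gt0.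
pose y := a * l ^+ 2 / eps ^+ 4.
have y1 : 1 <= y.
  rewrite /y ler_pdivlMr // mul1r.
  have e2 : eps ^+ 2 <= 1 / 4 by move: eps0 eps1; nra.
  have l2 : 1 / 4 <= l ^+ 2 by nra.
  have : eps ^+ 4 <= 1 / 16 by rewrite (exprD eps 2 2); move: (sqr_ge0 eps); nra.
  by move: a5; nra.
have kle : k%:R <= 2 * 64 ^+ 3 * y.
  have xE : 4 * K * l / d ^+ 2 = 64 ^+ 3 * y.
    by rewrite /y /K /level_threshold /d /slack -/a -/l; field; rewrite gt_eqF.
  have : (Num.truncn (4 * K * l / d ^+ 2))%:R <= 64 ^+ 3 * y.
    by rewrite xE truncn_le mulr_ge0 // (le_trans _ y1).
  have : 1 <= 64 ^+ 3 * y by rewrite mulr_ege1 // exprn_ege1 // ler1n.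
  have -> : k%:R = (Num.truncn (4 * K * l / d ^+ 2))%:R + 1 :> R by rewrite natr1.
  by move: (64 ^+ 3 : R) => B; lra.
have -> : 148 * (64 ^+ 3 * (c + e%:R + 4)) ^+ 2 * l ^+ 6 / eps ^+ 8 =
    148 * (64 ^+ 3 * (l * y)) ^+ 2.
  by rewrite /y -/confidence -/a; field; rewrite gt_eqF.
have B1 : 1 <= 64 ^+ 3 :> R by rewrite exprn_ege1 // ler1n.
move: kle B1; move: (64 ^+ 3) => B kle B1.
set z := B * (l * y).
have hk : h.+1%:R * k%:R <= 12 * z.
  have -> : 12 * z = (6 * l) * (2 * B * y) by rewrite /z; ring.
  by rewrite ler_pM.
have z1 : 1 / 2 <= z.
  have ly : 1 / 2 <= l * y by nra.
  by rewrite /z; nra.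
have hk2 : (h.+1%:R * k%:R) ^+ 2 <= (12 * z) ^+ 2.
  apply: lerXn2r => //; rewrite nnegrE; first by rewrite mulr_ge0.
  by rewrite mulr_ge0 // (le_trans _ z1) // divr_ge0.
have -> : (step_cost num_levels num_bases num_levels.+1)%:R = (h.+1%:R * k%:R) ^+ 2 + 1 :> R.
  by rewrite /step_cost muln0 add0n -natr1 !natrM; ring.
have z2 : 1 / 4 <= z ^+ 2 by nra.
by move: hk2 z2; rewrite exprMn; lra.
Qed.

End BadSeeds.

Unset Implicit Arguments.
Set Strict Implicit.
Local Open Scope classical_set_scope.
Local Open Scope ring_scope.

(* A randomized algorithm is a deterministic one depending on a random seed w,
   drawn from a probability space (Omega, P) independently of the updates. *)
Theorem theorem1p4 (R : realType) (c : R) (hc : 1 <= c) (k : nat) :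
  exists C : R, 0 < C /\
  forall (U : choiceType) (n : nat) (eps : R), 0 < eps -> eps < 1 / 2 ->
  exists (d : measure_display) (Omega : measurableType d)
         (P : probability Omega R) (alg : Omega -> dyn_algorithm R U),
  forall (T : nat) (M : nat -> matroid U) (u : nat -> update U),
  dynamic_matroid n T M u ->
  (forall w : Omega,
     respects_query_bound (C * ln n%:R ^+ 6 / eps ^+ 8) T (alg w) M u) /\
  (* simultaneous correctness at any n ^ k points in time *)
  (forall ts : seq nat, (size ts <= n ^ k)%N ->
     (forall t, t \in ts -> (t <= T)%N) ->
     let correct := [set w | forall t, t \in ts -> correct_at eps (alg w) M u t] in
     measurable correct /\ ((1 - n%:R `^ (- c))%:E <= P correct)%E).
Proof.
exists (148 * (64 ^+ 3 * (c + k%:R + 4)) ^+ 2); split.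
  have a0 : 0 < c + k%:R + 4 by have := ler0n R k; lra.
  by rewrite mulr_gt0 // exprn_gt0 // mulr_gt0 // exprn_gt0.
move=> U n eps eps0 eps1.
(* For [n <= 1] an algorithm without queries returns [0]: for [n = 0] this is the exact value, and
   for [n = 1] the required probability is [0]. *)
have [n2|n1] := ltnP 1 n; last first.
  exists default_measure_display, nat, (@uniform_nat R 0),
    (fun=> @DynAlgorithm R U unit (fun=> Return U tt) (fun _ _ => Return U tt) (fun=> 0%E)).
  move=> T M u [_ size_le]; split.
    move=> w; split => // t tT; split => //=.
    rewrite divr_ge0 ?exprn_ge0 ?(ltW eps0) // mulr_ge0 //.
      by rewrite mulr_ge0 // exprn_ge0 // mulr_ge0 // ?exprn_ge0 //; have := ler0n R k; lra.
    by rewrite exprn_even_ge0.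
  move=> ts _ tsT correct; split; first by [].
  case: n n1 size_le => [|[|//]] _ size_le; last first.
    by rewrite powR1 subrr; apply: measure_ge0.
  have -> : correct = setT.
    apply/seteqP; split => // w _ t /tsT tT; rewrite /correct_at covering_number_empty.
      by rewrite /estimate /= !mule0 lexx.
    by apply/eqP; rewrite -cardfs_eq0 -leqn0 size_le.
  rewrite probability_setT lee_fin gerBl.
  exact: powR_ge0.
pose h := num_levels n; pose m := num_bases c eps n k.
pose K := level_threshold c eps n k.
pose W : finType := {ffun 'I_n.+1 -> 'I_((2 ^ h).-1.+1)}.
pose w0 : W := [ffun=> ord0].
exists default_measure_display, nat, (@uniform_nat R #|W|.-1),
  (fun i => @packing_algorithm R U n h m h.+1 K (decode w0 i)).
move=> T M u dyn; have [_ size_le] := dyn.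
have nF : (n < 2 ^ h.+1)%N.
  apply: leq_ltn_trans (_ : 2 ^ h < _)%N; first exact: up_logP.
  by rewrite ltn_exp2l.
split=> [w|ts size_ts tsT correct].
  by apply: packing_algorithm_bound => //; apply: step_cost_le.
split; first by [].
pose good_at t w := correct_at eps (@packing_algorithm R U n h m h.+1 K w) M u t.
have bad t : exists Bad : {set W}, (forall w, w \notin Bad -> (t <= T)%N -> good_at t w) /\
    #|Bad|%:R <= #|W|%:R * expR (- ((c + k%:R) * ln n%:R)).
  have [tT|_] := leqP t T; last first.
    by exists finset.set0; split => //; rewrite cards0 mulr_ge0 ?expR_ge0.
  have [Bad [BadP cB]] := @bad_seeds R U c eps n k hc n2 eps0 eps1 (M t) (slot_at n M u t)
    (size_le _ tT) (slot_at_inj dyn tT).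
  exists Bad; split => // w /BadP good _.
  rewrite /good_at /correct_at /estimate (state_at_canonical (h := h) m K w nF dyn tT).
  exact: good.
have [Bad BadP] := boolp.choice bad.
apply: (@uniform_nat_ge R W w0 (\bigcup_(t <- ts) Bad t)%SET).
  move=> i iB t tts.
  apply: (BadP t).1; last exact: tsT.
  by apply: contra iB => iB; rewrite (big_rem t tts) /= inE iB.
have n0 : n%:R != 0 :> R by rewrite pnatr_eq0 -lt0n ltnW.
apply: (@le_trans _ _ (\sum_(t <- ts) #|Bad t|%:R)).
  rewrite -natr_sum ler_nat; apply: (big_ind2 (fun (A : {set W}) v => #|A| <= v)%N) => //.
    by rewrite cards0.
  move=> A v A' v' le le'; apply: leq_trans (leq_add le le').
  by rewrite cardsU leq_subr.
set x := expR _ in BadP.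
have x0 : 0 <= x := expR_ge0 _.
apply: (@le_trans _ _ (\sum_(t <- ts) #|W|%:R * x)).
  by apply: ler_sum => t _; exact: (BadP t).2.
rewrite big_const_seq count_predT iter_addr_0 -[leLHS]mulr_natr -mulrA ler_wpM2l //.
apply: (@le_trans _ _ (x * (n ^ k)%:R)).
  by rewrite ler_wpM2l // ler_nat.
rewrite /powR (negbTE n0) natrX /x.
have -> : n%:R ^+ k = expR (ln n%:R * k%:R) :> R.
  by rewrite expRM_natr lnK // posrE ltr0n ltnW.
by rewrite -expRD ler_expR; lra.
Qed.
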